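(* Let $m=1$ and $c>0$. Assume that $H(a,\alpha)<\infty$ for all $(a,\alpha)\in\mathbb{R}^{h+1}$, and that $(\bar W,\{\rho_k,\bar a_k\}_{k=1}^K)$ is a generalized subsolution/control to the Isaacs equation $$W_t(y,t)+\sup_{a\in\mathbb{R}^h}\inf_{(b,\beta)\in\mathbb{R}^{h+1}}\mathbb{H}(DW(y,t),a,b,\beta)=0$$ with $\bar W(y,1)<0$ for all $y\ge c$. For each $n$ let $\{\bar X^n_j\}_{1\le j\le n}$ and $\{\bar Y^n_j\}_{0\le j\le n}$ be generated from $(\rho_k,\bar a_k)$ by the sampling scheme described in the context. For $\lambda>0$, define $Z^n(\lambda)=[\lambda(\bar Y^n_n-c)+1]^+\,\bar\Upsilon^n$, where $$\bar\Upsilon^n=\prod_{j=0}^{n-1}\left[\sum_{k=1}^{K}\rho_k(\bar Y^n_j,j/n)\,e^{\langle\bar a_k(\bar Y^n_j,j/n),\bar X^n_{j+1}\rangle-H_1(\bar a_k(\bar Y^n_j,j/n))}\right]^{-1}.$$ Then $Z^n(\lambda)$ is an unbiased estimator of $\mathbb{E}[\lambda(Y_n-c)+1]^+$, where $Y_n=\frac1n\sum_{i=1}^nG(X_i)$, and there exists a $\gamma>0$ such that $$\sup_{\lambda\ge\gamma}\limsup_{n\to\infty}\frac1n\log\mathbb{E}[Z^n(\lambda)]^2\le-\bar W(0,0),$$ where $\mathbb{E}[Z^n(\lambda)]^2$ denotes the second moment $\mathbb{E}[(Z^n(\lambda))^2]$.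
   Context: Setting. $X_1,X_2,\dots$ are i.i.d. random variables in $\mathbb{R}^h$ with distribution $\eta$; $G:\mathbb{R}^h\to\mathbb{R}$ is continuous. For real $x$, $[x]^+=\max(x,0)$. Notation. For $a\in\mathbb{R}^h$, $\alpha\in\mathbb{R}$, $H(a,\alpha)=\log\mathbb{E}[e^{\langle a,X_1\rangle+\alpha G(X_1)}]$, and $H_1(a)=H(a,0)$. The Legendre transform of $H$ is $L(b,\beta)=\sup_{(a,\alpha)\in\mathbb{R}^{h+1}}\big(\langle a,b\rangle+\alpha\beta-H(a,\alpha)\big)$ for $(b,\beta)\in\mathbb{R}^{h+1}$ (possibly $+\infty$). For $s,\beta\in\mathbb{R}$, $a,b\in\mathbb{R}^h$, $$\mathbb{H}(s,a,b,\beta)=\langle a,b\rangle+s\beta+L(b,\beta)-H_1(a).$$ For a function $W$ of $(y,t)\in\mathbb{R}\times[0,1]$, $W_t$ and $DW$ denote the derivatives with respect to $t$ and $y$. Generalized subsolution/control. Given $K\in\mathbb{N}$ and functions $\bar W:\mathbb{R}\times[0,1]\to\mathbb{R}$, $\rho_k:\mathbb{R}\times[0,1]\to\mathbb{R}$, $\bar a_k:\mathbb{R}\times[0,1]\to\mathbb{R}^h$, $1\le k\le K$, the collection is a generalized subsolution/control to the Isaacs equation if: (i) $\rho_k(y,t)\ge0$ for all $k$ and $\sum_{k=1}^K\rho_k(y,t)=1$ for all $(y,t)\in\mathbb{R}\times[0,1]$; (ii) $\bar W$ is continuously differentiable and there are functions $r_k,s_k:\mathbb{R}\times[0,1]\to\mathbb{R}$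 with $\bar W_t(y,t)=\sum_{k=1}^K\rho_k(y,t)r_k(y,t)$ and $D\bar W(y,t)=\sum_{k=1}^K\rho_k(y,t)s_k(y,t)$; (iii) for each $k$ and all $(y,t)$, $r_k(y,t)+\inf_{(b,\beta)\in\mathbb{R}^{h+1}}\mathbb{H}(s_k(y,t),\bar a_k(y,t),b,\beta)\ge0$; (iv) the functions $r_k,s_k,\rho_k,\bar a_k$ are uniformly bounded and continuous. Sampling scheme. Fix $n$. Set $\bar Y^n_0=0$. For $j=0,\dots,n-1$, having constructed $\bar X^n_1,\dots,\bar X^n_j$ and $\bar Y^n_0,\dots,\bar Y^n_j$, generate a random index $I\in\{1,\dots,K\}$ with conditional probabilities $\mathbb{P}[I=k]=\rho_k(\bar Y^n_j,j/n)$; then sample $\bar X^n_{j+1}$ (conditionally on the past and on $I$) from the distribution $e^{\langle\bar a_I(\bar Y^n_j,j/n),x\rangle-H_1(\bar a_I(\bar Y^n_j,j/n))}\eta(dx)$, and set $\bar Y^n_{j+1}=\bar Y^n_j+\frac1nG(\bar X^n_{j+1})$. *)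

(* Defs.v *)
From HB Require Import structures.
From mathcomp Require Import all_boot all_order all_algebra.
From mathcomp Require Import all_classical all_reals all_analysis.
Import Order.TTheory GRing.Theory Num.Theory.
Import numFieldNormedType.Exports.

Set Implicit Arguments.
Unset Strict Implicit.
Unset Printing Implicit Defensive.

Local Open Scope classical_set_scope.
Local Open Scope ring_scope.

(* R^h with its Borel sigma-algebra. The carrier is convertible to 'rV[R]_h. *)
Definition borel_rV (R : realType) (h : nat) :=
  g_sigma_algebraType (@open 'rV[R]_h).

Definition dotp (R : realType) (h : nat) (a x : 'rV[R]_h) : R :=
  \sum_(i < h) a 0 i * x 0 i.

Definition pos_part (R : realType) (x : R) : R := Num.max x 0.

Section Hamiltonian.
Context {R : realType} {h : nat}.
Variables (eta : probability (borel_rV R h) R) (G : 'rV[R]_h -> R).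
Local Open Scope ereal_scope.

(* Values in \bar R, +oo when the exponential moment is infinite. *)
Definition logmgf (a : 'rV[R]_h) (alpha : R) : \bar R :=
  lne 'E_eta[fun x => expR (dotp a x + alpha * G x)].

Definition logmgf1 (a : 'rV[R]_h) : \bar R := logmgf a 0.

Definition Legendre (b : 'rV[R]_h) (beta : R) : \bar R :=
  ereal_sup [set (dotp p.1 b + p.2 * beta)%:E - logmgf p.1 p.2
            | p in [set: 'rV[R]_h * R]].

Definition Hamiltonian (s : R) (a b : 'rV[R]_h) (beta : R) : \bar R :=
  (dotp a b + s * beta)%:E + Legendre b beta - logmgf1 a.

Definition tilt_density (a x : 'rV[R]_h) : R :=
  expR (dotp a x - fine (logmgf1 a))%R.

Definition tilted (a : 'rV[R]_h) (B : set (borel_rV R h)) : \bar R :=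
  \int[eta]_(x in B) (tilt_density a x)%:E.

End Hamiltonian.

(* A function on R x [0,1] is represented by a function R -> R -> _ whose
   values for a second argument outside [0,1] are irrelevant. *)
Section Strip.
Context {R : realType}.

Definition strip : set (R * R) := [set p | 0 <= p.2 <= 1].

Definition continuous_on_strip (V : topologicalType) (f : R -> R -> V) : Prop :=
  {within strip, continuous (fun p : R * R => f p.1 p.2)}.

(* The t-derivative is taken within [0,1], hence one-sided at t = 0, 1. *)
Record continuously_differentiable (W Wt DW : R -> R -> R) : Prop := {
  cd_DW : forall y t : R, 0 <= t <= 1 ->
    is_derive y (1 : R) (W ^~ t) (DW y t) ;
  cd_Wt : forall y t : R, 0 <= t <= 1 ->
    (u - t)^-1 * (W y u - W y t) @[u --> within `[0, 1] t^'] --> Wt y t ;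
  cd_DW_cont : continuous_on_strip DW ;
  cd_Wt_cont : continuous_on_strip Wt }.

End Strip.

Section Subsolution.
Context {R : realType} {h : nat}.
Variables (eta : probability (borel_rV R h) R) (G : 'rV[R]_h -> R).

Record generalized_subsolution (K : nat) (W : R -> R -> R)
    (rho : 'I_K -> R -> R -> R) (abar : 'I_K -> R -> R -> 'rV[R]_h)
    (Wt DW : R -> R -> R) (r s : 'I_K -> R -> R -> R) : Prop := {
  gs_rho_ge0 : forall k (y t : R), 0 <= t <= 1 -> 0 <= rho k y t ;
  gs_rho_sum1 : forall y t : R, 0 <= t <= 1 -> \sum_(k < K) rho k y t = 1 ;
  gs_C1 : continuously_differentiable W Wt DW ;
  gs_Wt : forall y t : R, 0 <= t <= 1 ->
    Wt y t = \sum_(k < K) rho k y t * r k y t ;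
  gs_DW : forall y t : R, 0 <= t <= 1 ->
    DW y t = \sum_(k < K) rho k y t * s k y t ;
  gs_Isaacs : forall k (y t : R), 0 <= t <= 1 ->
    (0 <= (r k y t)%:E +
       ereal_inf [set Hamiltonian eta G (s k y t) (abar k y t) p.1 p.2
                 | p in [set: 'rV[R]_h * R]])%E ;
  gs_bounded : exists M : R, forall k (y t : R), 0 <= t <= 1 ->
    [/\ `|r k y t| <= M, `|s k y t| <= M, `|rho k y t| <= M
      & `|abar k y t| <= M] ;
  gs_continuous : forall k,
    [/\ continuous_on_strip (r k), continuous_on_strip (s k),
        continuous_on_strip (rho k) & continuous_on_strip (abar k)] }.

Definition is_generalized_subsolution (K : nat) (W : R -> R -> R)
    (rho : 'I_K -> R -> R -> R) (abar : 'I_K -> R -> R -> 'rV[R]_h) : Prop :=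
  exists Wt DW r s, generalized_subsolution W rho abar Wt DW r s.

End Subsolution.

Section Probability.
Context {R : realType} {d : measure_display} {Omega : measurableType d}.
Variable P : probability Omega R.

Definition mutually_independent d' (T : measurableType d')
    (X : nat -> {RV P >-> T}) : Prop :=
  forall (J : seq nat) (B : nat -> set T), uniq J ->
    (forall i, measurable (B i)) ->
    P (\bigcap_(i in [set` J]) X i @^-1` B i)
    = (\prod_(i <- J) P (X i @^-1` B i))%E.

Definition iid d' (T : measurableType d') (X : nat -> {RV P >-> T})
    (mu : probability T R) : Prop :=
  (forall i B, measurable B -> distribution P (X i) B = mu B) /\
  mutually_independent X.

Definition unbiased_estimator (Z : Omega -> R) (v : \bar R) : Prop :=
  P.-integrable [set: Omega] (EFin \o Z) /\ 'E_P[Z]%E = v.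

(* Sequences of samples are indexed from 0: X j stands for X_{j+1}. *)
Definition sample_mean (h : nat) (G : 'rV[R]_h -> R)
    (X : nat -> {RV P >-> borel_rV R h}) (n : nat) (w : Omega) : R :=
  n%:R^-1 * \sum_(i < n) G (X i w).

(* The sigma-algebra generated by the first j samples. *)
Definition history d' (T : measurableType d') (X : nat -> {RV P >-> T})
    (j : nat) : set (set Omega) :=
  <<s \bigcup_(i in [set i | (i < j)%N])
        preimage_set_system [set: Omega] (X i) measurable >>.

End Probability.

Section Scheme.
Context {R : realType} {h : nat}.
Variables (eta : probability (borel_rV R h) R) (G : 'rV[R]_h -> R).
Context {K : nat}.
Variables (rho : 'I_K -> R -> R -> R) (abar : 'I_K -> R -> R -> 'rV[R]_h).
Context {d : measure_display} {Omega : measurableType d}.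
Variable P : probability Omega R.

(* X j is the sample X_{j+1}, and I j the index drawn in order to generate it.
   Conditional laws are given by the defining property of conditional
   probability, against all events of the past. *)
Record sampling_scheme (n : nat) (X : nat -> {RV P >-> borel_rV R h})
    (I : nat -> Omega -> 'I_K) (Y : nat -> Omega -> R) : Prop := {
  ss_Y0 : forall w, Y 0%N w = 0 ;
  ss_YS : forall j w, (j < n)%N -> Y j.+1 w = Y j w + n%:R^-1 * G (X j w) ;
  ss_I_measurable : forall j k, (j < n)%N -> measurable (I j @^-1` [set k]) ;
  ss_I : forall j k A, (j < n)%N -> history X j A ->
    P (A `&` I j @^-1` [set k]) =
    (\int[P]_(w in A) (rho k (Y j w) (j%:R / n%:R))%:E)%E ;
  ss_X : forall j k A B, (j < n)%N -> history X j A -> measurable B ->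
    P (A `&` I j @^-1` [set k] `&` X j @^-1` B) =
    (\int[P]_(w in A `&` I j @^-1` [set k])
       tilted eta G (abar k (Y j w) (j%:R / n%:R)) B)%E }.

Definition likelihood_ratio (n : nat) (X : nat -> {RV P >-> borel_rV R h})
    (Y : nat -> Omega -> R) (w : Omega) : R :=
  \prod_(j < n)
    (\sum_(k < K) rho k (Y j w) (j%:R / n%:R) *
       tilt_density eta G (abar k (Y j w) (j%:R / n%:R)) (X j w))^-1.

Definition IS_estimator (c : R) (n : nat) (X : nat -> {RV P >-> borel_rV R h})
    (Y : nat -> Omega -> R) (lam : R) (w : Omega) : R :=
  pos_part (lam * (Y n w - c) + 1) * likelihood_ratio n X Y w.

End Scheme.

(* Main.v *)
Require Import Defs.
From HB Require Import structures.
From mathcomp Require Import all_boot all_order all_algebra.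
From mathcomp Require Import all_classical all_reals all_analysis.
From mathcomp Require Import measurable_realfun ring lra.
Import Order.TTheory GRing.Theory Num.Theory.
Import numFieldNormedType.Exports.
Set Implicit Arguments.
Unset Strict Implicit.
Unset Printing Implicit Defensive.
Local Open Scope classical_set_scope.
Local Open Scope ring_scope.

(** Both claims are reduced to integrals against [eta] by integrating out the
    samples one at a time, from the last to the first.

    Given the past, the next sample of the scheme has density
    [q = \sum_k rho_k * tilt_density a_k] with respect to [eta]
    ([scheme_conditional_density]), and the likelihood ratio is the product of
    the inverses [1/q].  For a process whose samples have conditional densities
    [q j], the mean of a function of the last position times a product of
    weights [ell j] is computed by a backward recursion in the position alone
    ([expectation_backward]): one step maps [Phi] to
    [y |-> \int Phi (y + G x / n) * ell j (y, x) * q j (y, x) eta(dx)].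
    With [ell = 1/q] the factor is 1, and so it is for independent samples with
    no weight at all.  The two means are therefore given by the same iterated
    operator, which is the unbiasedness.

    For the second moment [ell = 1/q^2] and the factor is [1/q].  It suffices
    to find positive functions [U j] that decrease under this recursion,
    dominate the squared payoff at the final time up to a constant, and satisfy
    [U 0 0 <= 2 * exp (n * (e - W 0 0))], for an arbitrary [e > 0].  The candidate is
    [exp (- n * W y (j / n))].  In the Isaacs inequality one may take for
    [(b, beta)] the mean of [(X, G X)] under the law tilted by [(- a_k, - s_k)]:
    it is a subgradient of the log-moment generating function [H] there, so the
    infimum is at most [- H (- a_k, - s_k) - H_1 a_k], and the inequality reads
    [H (- a_k, - s_k) + H_1 a_k <= r_k] ([Isaacs_mgf_le]).  By convexity of the
    exponential, [1/q * exp (- DW * G - W_t)] is at most the mixture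
    [\sum_k rho_k exp (- u_k - s_k G - r_k)], where [u_k] is the logarithm of
    the [k]-th tilted density, and by the previous inequality this mixture has
    integral at most 1 ([integral_kernel_le1]).  Hence the candidate
    decreases up to the error made in replacing the increment of [n * W] by
    [DW * G + W_t].

    That error is uniformly small only when [y] and [G x] stay in a compact
    set.  Large values of [G x] cost a factor that the exponential moments of
    [G] make small; large values of [y] are absorbed by a second term
    [exp (n * theta * (`|y| - B))] of [U j], whose slope [theta] beats the
    linear growth of [W] and whose threshold [B] is so large that the term is
    negligible at the origin ([potential_step]).  Finally [W _ 1] is negative
    on a half-line starting to the left of [c]; once [1 / lambda] is smaller
    than that margin, the payoff vanishes outside this half-line, and on it
    [exp (- n * W y 1)] is at least 1 ([payoff_le_potential]).  The margin
    depends on [W] and [c] only, which makes the bound uniform in [lambda]. *)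

(** * Measures with a density *)

Section Density.
Local Open Scope ereal_scope.
Context d (T : measurableType d) (R : realType).
Import HBNNSimple.

(** Approximation of [f] from below by simple functions reduces the formula to
    indicators, for which it is the hypothesis. *)
Lemma ge0_integral_density (nu mu : {measure set T -> \bar R})
    (g : T -> R) (f : T -> \bar R) :
  measurable_fun [set: T] g -> (forall x, (0 <= g x)%R) ->
  (forall A, measurable A -> nu A = \int[mu]_(x in A) (g x)%:E) ->
  measurable_fun [set: T] f -> (forall x, 0 <= f x) ->
  \int[nu]_x f x = \int[mu]_x (f x * (g x)%:E).
Proof.
move=> mg g0 nuE mf f0.
pose h := nnsfun_approx measurableT mf.
have cvh x : EFin \o h ^~ x @ \oo --> f x by exact: cvg_nnsfun_approx.
have ndh x : {homo (fun n => (h n x)%:E) : n m / (n <= m)%N >-> n <= m}.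
  by move=> n m nm; rewrite lee_fin; exact/lefP/nd_nnsfun_approx.
have intsf n : \int[nu]_x (h n x)%:E = \int[mu]_x ((h n x)%:E * (g x)%:E).
  have mge : measurable_fun [set: T] (fun x => (g x)%:E) by exact/measurable_EFinP.
  have mh : measurable_fun [set: T] (h n) by [].
  rewrite integralT_nnsfun sintegralE.
  under [in RHS]eq_integral => x _.
    rewrite (fimfunE (h n) x) -fsumEFin// ge0_mule_fsuml; last first.
      move=> r; rewrite EFinM; case: (ltP r 0%R) => r0.
        by rewrite preimage_nnfun0// indic0 mule0.
      by rewrite -EFinM lee_fin mulr_ge0.
    over.
  rewrite ge0_integral_fsum//=.
  - apply: eq_fsbigr => r _; case: (ltP r 0%R) => r0.
      rewrite preimage_nnfun0// measure0 mule0.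
      by rewrite integral0_eq// => x _; rewrite indic0 mulr0 mul0e.
    rewrite nuE// integral_mkcond -ge0_integralZl_EFin//.
    - apply: eq_integral => x _; rewrite patchE /= indicE EFinM.
      by case: ifPn => xr; rewrite ?mule1 ?mule0 ?mul0e.
    - by move=> x _; rewrite patchE; case: ifPn => _; rewrite ?lee_fin.
    - exact/(measurable_restrictT _ _).1/measurable_funTS.
  - move=> r; apply: emeasurable_funM => //.
    by apply/measurable_EFinP; apply: measurable_funM => //; exact: measurable_indic.
  - move=> r x _; rewrite EFinM; case: (ltP r 0%R) => r0.
      by rewrite preimage_nnfun0// indic0 mule0 mul0e.
    by rewrite -EFinM -EFinM lee_fin !mulr_ge0.
transitivity (limn (fun n => \int[nu]_x (h n x)%:E)).
  rewrite -monotone_convergence//.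
  - by apply: eq_integral => x _; apply/esym/cvg_lim => //; exact: cvh.
  - by move=> n; exact/measurable_EFinP.
  - by move=> n x _; rewrite lee_fin.
under eq_fun do rewrite intsf.
rewrite -monotone_convergence//.
- apply: eq_integral => x _; apply/cvg_lim => //.
  by apply: cvgeZr => //; exact: cvh.
- by move=> n; apply: emeasurable_funM => //; exact/measurable_EFinP.
- by move=> n x _; rewrite mule_ge0// lee_fin.
- by move=> x _ n m nm; apply: lee_wpmul2r; [rewrite lee_fin | exact: ndh].
Qed.

End Density.

Section Disintegration.
Local Open Scope ereal_scope.

Lemma density_measure d (T : measurableType d) (R : realType)
    (mu : {measure set T -> \bar R}) (g : T -> R) :
  measurable_fun [set: T] g -> (forall x, (0 <= g x)%R) ->
  exists nu : {measure set T -> \bar R},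
    forall A, nu A = \int[mu]_(x in A) (g x)%:E.
Proof.
move=> mg g0; pose m A := \int[mu]_(x in A) (g x)%:E.
have m0 : m set0 = 0 by rewrite /m integral_set0.
have m_ge0 A : 0 <= m A by apply: integral_ge0 => x _; rewrite lee_fin.
have m_add : semi_sigma_additive m.
  move=> F mF tF mUF; rewrite /m ge0_integral_bigcup//.
  - by apply: is_cvg_ereal_nneg_natsum_cond => n _ _; exact: m_ge0.
  - exact/measurable_funTS/measurable_EFinP.
  - by move=> x _; rewrite lee_fin.
pose mm := isMeasure.Build _ _ _ m m0 m_ge0 m_add.
by exists (HB.pack_for {measure set T -> \bar R} m mm).
Qed.

Context d d1 d2 (Omega : measurableType d) (T1 : measurableType d1)
  (T2 : measurableType d2) (R : realType).
Variables (P : probability Omega R) (eta : probability T2 R).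
Variables (S : {RV P >-> T1}) (X : {RV P >-> T2}) (q : T1 * T2 -> R).

(** The hypothesis says that the joint law of [(S, X)] agrees on rectangles with
    the measure of density [q] with respect to the product of the law of [S] and
    [eta]; rectangles form a generating pi-system, so the two measures are equal
    and the formula is Tonelli's theorem. *)
Lemma ge0_integral_disintegration :
  measurable_fun [set: T1 * T2] q -> (forall z, (0 <= q z)%R) ->
  (forall C B, measurable C -> measurable B ->
    P (S @^-1` C `&` X @^-1` B) =
    \int[P]_(w in S @^-1` C) \int[eta]_(x in B) (q (S w, x))%:E) ->
  forall f : T1 * T2 -> \bar R,
  measurable_fun [set: T1 * T2] f -> (forall z, 0 <= f z) ->
  \int[P]_w f (S w, X w) =
  \int[P]_w \int[eta]_x (f (S w, x) * (q (S w, x))%:E).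
Proof.
move=> mq q0 PE f mf f0.
have mqE : measurable_fun [set: T1 * T2] (fun z => (q z)%:E).
  exact/measurable_EFinP.
pose SX w := (S w, X w).
have mSX : measurable_fun [set: Omega] SX by exact: measurable_fun_pair.
pose SXm := isMeasurableFun.Build _ _ _ _ _ mSX.
pose SX' := HB.pack_for {mfun Omega >-> (T1 * T2)%type} SX SXm.
pose mS := distribution P S.
pose mu := (mS \x eta)%E.
have [nu nuE] := density_measure mu mq q0.
have key A : measurable A -> distribution P SX' A = nu A.
  apply: (measure_unique
    [set C | exists2 A, measurable A & exists2 B, measurable B & C = A `*` B]
    (fun=> setT)) => //.
  - rewrite measurable_prod_measurableType; congr (<<s _ >>).
    by rewrite eqEsubset; split=> C [B mB [D mD BD]]; exists B => //; exists D.
  - move=> _ _ [A1 mA1 [B1 mB1 ->]] [A2 mA2 [B2 mB2 ->]]; rewrite -setXI.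
    exists (A1 `&` A2); first exact: measurableI.
    by exists (B1 `&` B2) => //; exact: measurableI.
  - by move=> _; exists setT => //; exists setT => //; rewrite setXTT.
  - by rewrite bigcup_const.
  - move=> _ [C mC [B mB ->]].
    rewrite nuE /distribution /pushforward /=.
    rewrite -[LHS]/(P (S @^-1` C `&` X @^-1` B)) PE//.
    pose p := (fun z => (q z)%:E) \_ (C `*` B).
    have mp : measurable_fun [set: T1 * T2] p.
      apply/(measurable_restrictT _ _).1; first exact: measurableX.
      exact: measurable_funTS.
    have p0 z : 0 <= p z.
      by rewrite /p patchE; case: ifPn; rewrite // lee_fin.
    rewrite [RHS]integral_mkcond /mu fubini_tonelli1//=.
    have mFp := @measurable_fun_fubini_tonelli_F _ _ _ _ _ eta p mp p0.
    rewrite (ge0_integral_distribution _ mFp); last first.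
      by move=> s; apply: integral_ge0.
    rewrite [LHS]integral_mkcond; refine (eq_integral _ _ _) => w _.
    rewrite patchE /= /fubini_F; case: ifPn => wC.
      rewrite [LHS]integral_mkcond; refine (eq_integral _ _ _) => x _.
      rewrite /p !patchE in_setX/=.
      by move: wC; rewrite inE /= -in_setE => ->.
    rewrite integral0_eq// => x _; rewrite /p patchE in_setX/=.
    by move: wC; rewrite notin_setE /= => wC; rewrite memNset.
  - by move=> _; rewrite /= probability_setT ltry.
rewrite -[LHS]/(\int[P]_w (f \o SX') w) -ge0_integral_distribution//.
rewrite (eq_measure_integral nu) => [|A mA _]; last exact: key.
rewrite (ge0_integral_density mq q0 (fun A _ => nuE A) mf f0) /mu.
rewrite fubini_tonelli1//; last 2 first.
- exact: emeasurable_funM.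
- by move=> z; rewrite mule_ge0 ?lee_fin.
rewrite ge0_integral_distribution//.
- apply: measurable_fun_fubini_tonelli_F; first exact: emeasurable_funM.
  by move=> z; rewrite mule_ge0 ?lee_fin.
- by move=> s; apply: integral_ge0 => x _; rewrite mule_ge0 ?lee_fin.
Qed.
End Disintegration.

Section EventDensity.
Local Open Scope ereal_scope.
Context d d1 (Omega : measurableType d) (T : measurableType d1) (R : realType).
Variables (P : probability Omega R) (S : {RV P >-> T}).

(** Conditioning on a discrete outcome: [E] is one value of a random index, and
    [rho] is the conditional probability of that value given [S]. *)
Lemma ge0_integral_event_density (E : set Omega) (rho : T -> R) :
  measurable E -> measurable_fun [set: T] rho -> (forall s, (0 <= rho s)%R) ->
  (forall C, measurable C ->
    P (S @^-1` C `&` E) = \int[P]_(w in S @^-1` C) (rho (S w))%:E) ->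
  forall f : T -> \bar R, measurable_fun [set: T] f -> (forall s, 0 <= f s) ->
  \int[P]_(w in E) f (S w) = \int[P]_w (f (S w) * (rho (S w))%:E).
Proof.
move=> mE mrho rho0 PE f mf f0.
have m1E : measurable_fun [set: Omega] (\1_E : Omega -> R).
  exact: measurable_indic.
have [PrE PrEE] := @density_measure _ _ _ P _ m1E (fun=> ler0n _ _).
have [nu nuE] := @density_measure _ _ _ (distribution P S) _ mrho rho0.
transitivity (\int[PrE]_w f (S w)).
  rewrite (ge0_integral_density m1E (fun=> ler0n _ _) (fun A _ => PrEE A))//.
  - rewrite [LHS]integral_mkcond; refine (eq_integral _ _ _) => w _.
    by rewrite epatch_indic.
  - exact: measurableT_comp.
have mS : measurable_fun [set: Omega] S by [].
rewrite -(ge0_integral_pushforward mS PrE measurableT mf)//.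
rewrite (eq_measure_integral nu) => [|A mA _].
  rewrite (ge0_integral_density mrho rho0 (fun A _ => nuE A) mf f0).
  rewrite ge0_integral_distribution//.
  - by apply: emeasurable_funM => //; exact/measurable_EFinP.
  - by move=> s; rewrite mule_ge0 ?lee_fin.
have mSA : measurable (S @^-1` A) by rewrite -[X in measurable X]setTI; exact: mS.
rewrite nuE -[LHS]/(PrE (S @^-1` A)) PrEE integral_indic//.
transitivity (P (S @^-1` A `&` E)); first by congr (P _); exact: setIC.
rewrite PE// [RHS]ge0_integral_pushforward//.
- exact/measurable_funTS/measurable_EFinP.
- by move=> s _; rewrite lee_fin.
Qed.

End EventDensity.

(** * Exponential moments of the sampling distribution *)

Section BorelVectors.
Context {R : realType} {h : nat}.
Local Notation rVb := (borel_rV R h).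

Lemma measurable_continuous_borel_rV (f : 'rV[R]_h -> R) :
  continuous f -> measurable_fun [set: rVb] (f : rVb -> R).
Proof.
move=> /continuousP cf; apply: (measurability _ (RGenOpens.measurableE R)).
move=> _ [_ [a [b ->] <-]]; rewrite setTI; apply: sub_sigma_algebra.
exact/cf/interval_open.
Qed.

Lemma measurable_borel_rV_continuous (f : R -> 'rV[R]_h) :
  continuous f -> measurable_fun [set: R] (f : R -> rVb).
Proof.
move=> /continuousP cf; apply: (@measurability _ _ _ rVb _ _ (@open 'rV[R]_h)) => //.
move=> _ [U oU <-]; rewrite setTI; apply: open_measurable; exact: cf.
Qed.

Lemma measurable_dotp d (T : measurableType d) (a x : T -> rVb) :
  measurable_fun [set: T] a -> measurable_fun [set: T] x ->
  measurable_fun [set: T] (fun t => dotp (a t) (x t)).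
Proof.
move=> ma mx; apply: measurable_sum => i.
have mi : measurable_fun [set: rVb] (fun v : rVb => v 0 i : R).
  by apply: measurable_continuous_borel_rV; exact: coord_continuous.
by apply: measurable_funM; apply: (measurableT_comp mi).
Qed.

Lemma normr_dotp_le (a x : 'rV[R]_h) :
  `|dotp a x| <= `|a| * \sum_i `|x 0 i|.
Proof.
rewrite mulr_sumr; apply: (le_trans (ler_norm_sum _ _ _)).
apply: ler_sum => i _; rewrite normrM ler_wpM2r//.
rewrite [leRHS]/Num.norm /= mx_normrE.
by apply/bigmax_geP; right => /=; exists (0, i).
Qed.

Lemma dotpDl (a b x : 'rV[R]_h) : dotp (a + b) x = dotp a x + dotp b x.
Proof. by rewrite -big_split; apply: eq_bigr => i _; rewrite mxE mulrDl. Qed.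

Lemma dotpNl (a x : 'rV[R]_h) : dotp (- a) x = - dotp a x.
Proof. by rewrite -sumrN; apply: eq_bigr => i _; rewrite mxE mulNr. Qed.

End BorelVectors.

(** A nonnegative function with null integral vanishes almost everywhere, which
    an exponential never does. *)
Lemma integral_expR_gt0 d (T : measurableType d) (R : realType)
    (P : probability T R) (U : T -> R) :
  measurable_fun [set: T] U -> (0 < \int[P]_x (expR (U x))%:E)%E.
Proof.
move=> mU; rewrite lt0e integral_ge0 ?andbT; last first.
  by move=> x _; rewrite lee_fin expR_ge0.
apply/negP => /eqP int0.
have mf : measurable_fun [set: T] (fun x => (expR (U x))%:E).
  by apply/measurable_EFinP; exact: measurableT_comp.
have : (\int[P]_x `|(expR (U x))%:E| = 0)%E.
  by rewrite -[RHS]int0; apply: eq_integral => x _; rewrite gee0_abs// lee_fin expR_ge0.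
move=> /(ae_eq_integral_abs _ measurableT mf)[N [mN PN0 NE]].
have : (P setT = 0)%E.
  apply/eqP; rewrite -measure_le0 -PN0 le_measure ?inE// => x _.
  by apply: NE => /= /(_ I) [] /eqP; rewrite gt_eqF// expR_gt0.
by rewrite probability_setT => /eqP; rewrite onee_eq0.
Qed.

Section ExponentialMoments.
Context {R : realType} {h : nat}.
Local Notation rVb := (borel_rV R h).
Variables (eta : probability rVb R) (G : 'rV[R]_h -> R).
Hypothesis cG : continuous G.
Hypothesis finH : forall a alpha, (logmgf eta G a alpha < +oo)%E.

Definition mgf (a : 'rV[R]_h) (alpha : R) : R :=
  fine (\int[eta]_x (expR (dotp a x + alpha * G x))%:E).

Let mG : measurable_fun [set: rVb] (G : rVb -> R).
Proof. exact: measurable_continuous_borel_rV. Qed.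

Lemma measurable_affine (a : 'rV[R]_h) (alpha : R) :
  measurable_fun [set: rVb] (fun x : rVb => dotp a x + alpha * G x).
Proof.
apply: measurable_funD; last exact: measurable_funM.
by apply: (@measurable_dotp _ _ _ _ (fun=> a) id).
Qed.

Lemma integral_expR_affine (a : 'rV[R]_h) (alpha : R) :
  (\int[eta]_x (expR (dotp a x + alpha * G x))%:E = (mgf a alpha)%:E)%E.
Proof.
rewrite /mgf fineK// fin_numElt; apply/andP; split.
  by rewrite (lt_trans _ (integral_expR_gt0 _ (measurable_affine a alpha)))// ltNy0.
have := finH a alpha; rewrite /logmgf unlock.
by case: (\int[eta]_x _)%E => //= r _; rewrite ltry.
Qed.

Lemma mgf_gt0 (a : 'rV[R]_h) (alpha : R) : 0 < mgf a alpha.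
Proof.
by rewrite -lte_fin -integral_expR_affine integral_expR_gt0//; exact: measurable_affine.
Qed.

Lemma logmgfE (a : 'rV[R]_h) (alpha : R) :
  logmgf eta G a alpha = (ln (mgf a alpha))%:E.
Proof.
by rewrite /logmgf unlock integral_expR_affine lne_EFin// mgf_gt0.
Qed.

Lemma measurable_mgf d (T : measurableType d) (a : T -> rVb) :
  measurable_fun [set: T] a -> measurable_fun [set: T] (fun t => mgf (a t) 0).
Proof.
move=> ma; apply: measurableT_comp; first exact: fine_measurable.
apply: (@measurable_fun_fubini_tonelli_F _ _ _ _ _ eta
  (fun z : T * rVb => (expR (dotp (a z.1) z.2 + 0 * G z.2))%:E)).
  apply/measurable_EFinP; apply: measurableT_comp => //.
  apply: measurable_funD; first by apply: measurable_dotp; [exact: measurableT_comp|].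
  by under eq_fun do rewrite mul0r; exact: measurable_cst.
by move=> z; rewrite lee_fin expR_ge0.
Qed.

Lemma measurable_tilt_density d (T : measurableType d) (a x : T -> rVb) :
  measurable_fun [set: T] a -> measurable_fun [set: T] x ->
  measurable_fun [set: T] (fun t => tilt_density eta G (a t) (x t)).
Proof.
move=> ma mx; apply: measurableT_comp => //.
apply: measurable_funB; first exact: measurable_dotp.
rewrite (_ : (fun _ => _) = (@ln R) \o (fun t => mgf (a t) 0)); last first.
  by apply/funext => t /=; rewrite /logmgf1 logmgfE.
by apply: measurableT_comp; [exact: measurable_ln|exact: measurable_mgf].
Qed.

End ExponentialMoments.

Lemma Rintegral_sum d (T : measurableType d) (R : realType)
    (mu : {measure set T -> \bar R}) (I : Type) (s : seq I) (F : I -> T -> R) :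
  (forall i, mu.-integrable [set: T] (EFin \o F i)) ->
  \int[mu]_x (\sum_(i <- s) F i x) = \sum_(i <- s) \int[mu]_x F i x.
Proof.
move=> iF; elim: s => [|i s IHs].
  by under eq_Rintegral do rewrite big_nil; rewrite Rintegral_cst// mul0r big_nil.
under eq_Rintegral do rewrite big_cons.
rewrite RintegralD//; first by rewrite IHs big_cons.
rewrite (_ : _ \o _ = fun x => (\sum_(j <- s) (EFin \o F j) x)%E).
  by apply: integrable_sum.
by apply/funext => x /=; rewrite sumEFin.
Qed.

Lemma integrable_EFinZl d (T : measurableType d) (R : realType)
    (mu : {measure set T -> \bar R}) (f : T -> R) (k : R) :
  mu.-integrable [set: T] (EFin \o f) ->
  mu.-integrable [set: T] (EFin \o (fun x => k * f x)).
Proof.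
move=> intf; rewrite (_ : _ \o _ = fun x => (k%:E * (EFin \o f) x)%E)//.
exact: integrableZl.
Qed.

Section Duality.
Context {R : realType} {h : nat}.
Local Notation rVb := (borel_rV R h).
Variables (eta : probability rVb R) (G : 'rV[R]_h -> R).
Hypothesis cG : continuous G.
Hypothesis finH : forall a alpha, (logmgf eta G a alpha < +oo)%E.

Let mG : measurable_fun [set: rVb] (G : rVb -> R).
Proof. exact: measurable_continuous_borel_rV. Qed.

Let coord_measurable i : measurable_fun [set: rVb] (fun x : rVb => x 0 i : R).
Proof. by apply: measurable_continuous_borel_rV; exact: coord_continuous. Qed.

Definition abs_size (x : 'rV[R]_h) : R := \sum_i `|x 0 i| + `|G x|.

Lemma abs_size_ge0 x : 0 <= abs_size x.
Proof. by rewrite addr_ge0// sumr_ge0. Qed.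

Lemma measurable_abs_size : measurable_fun [set: rVb] (abs_size : rVb -> R).
Proof.
apply: measurable_funD; last exact: measurableT_comp.
by apply: measurable_sum => i; exact: measurableT_comp.
Qed.

(** The exponential of a sum of absolute values is dominated by the sum, over
    all choices of signs, of exponentials of linear forms, and each of these has
    finite mean. *)
Lemma integral_expR_abs_size_lty (C : R) :
  (\int[eta]_x (expR (C * abs_size x))%:E < +oo)%E.
Proof.
pose sgn (b : bool) (z : R) : R := (if b then z else - z).
pose F (u : {ffun 'I_h -> bool} * bool) (x : rVb) :=
  expR (dotp (\row_i sgn (u.1 i) C) x + sgn u.2 C * G x).
have mF u : measurable_fun [set: rVb] (fun x => (F u x)%:E).
  by apply/measurable_EFinP/measurableT_comp => //; exact: measurable_affine.
apply: (@le_lt_trans _ _ (\int[eta]_x (\sum_u (F u x)%:E)%E)%E).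
  apply: ge0_le_integral => //.
  - apply/measurable_EFinP/measurableT_comp => //.
    by apply: measurable_funM => //; exact: measurable_abs_size.
  - exact: emeasurable_sum.
  - move=> x _; rewrite sumEFin lee_fin.
    pose u := ([ffun i => 0 <= x 0 i], 0 <= G x).
    suff -> : expR (C * abs_size x) = F u x.
      by rewrite (bigD1 u)//= lerDl sumr_ge0// => v _; exact: expR_ge0.
    have sgnM (z : R) : C * `|z| = sgn (0 <= z) C * z.
      by rewrite /sgn; case: ger0P => _; rewrite ?mulrN ?mulNr.
    have -> : C * abs_size x = \sum_i C * `|x 0 i| + C * `|G x|.
      by rewrite /abs_size mulrDr mulr_sumr.
    rewrite (sgnM (G x)) /F; apply: congr1; apply: (congr1 (+%R^~ _)).
    by apply: eq_bigr => i _; rewrite (sgnM (x 0 i)) mxE ffunE.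
rewrite ge0_integral_sum//; last by move=> u x _; rewrite lee_fin expR_ge0.
by apply/lte_sum_pinfty => u _; rewrite integral_expR_affine// ltry.
Qed.

Lemma le_expR_abs_size_integrable (f : rVb -> R) (C : R) :
  measurable_fun [set: rVb] f -> (forall x, `|f x| <= expR (C * abs_size x)) ->
  eta.-integrable [set: rVb] (EFin \o f).
Proof.
move=> mf fC; apply/integrableP; split; first exact/measurable_EFinP.
apply: le_lt_trans (integral_expR_abs_size_lty C).
apply: ge0_le_integral => //.
- by apply: measurableT_comp => //; exact/measurable_EFinP.
- apply/measurable_EFinP/measurableT_comp => //.
  by apply: measurable_funM => //; exact: measurable_abs_size.
- by move=> x _; rewrite lee_fin.
Qed.

Lemma affine_le_abs_size (a : 'rV[R]_h) (alpha C : R) (x : 'rV[R]_h) :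
  `|a| <= C -> `|alpha| <= C -> dotp a x + alpha * G x <= C * abs_size x.
Proof.
move=> aC alC; rewrite mulrDr lerD//.
  by rewrite (le_trans (ler_norm _))// (le_trans (normr_dotp_le _ _))// ler_wpM2r ?sumr_ge0.
by rewrite (le_trans (ler_norm _))// normrM ler_wpM2r.
Qed.

(** The point [(b, beta)] is the mean of [(X, G X)] under the law tilted by
    [(a, alpha)].  The inequality is Jensen's inequality for that law, obtained
    here from [exp v * (1 + (V - v)) <= exp V]; it says that [(b, beta)] is a
    subgradient of the logarithm of [mgf] at [(a, alpha)]. *)
Lemma mgf_gradient_le (a : 'rV[R]_h) (alpha : R) :
  exists (b : 'rV[R]_h) (beta : R), forall a' alpha',
    mgf eta G a alpha * expR (dotp (a' - a) b + (alpha' - alpha) * beta)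
      <= mgf eta G a' alpha'.
Proof.
pose p x := expR (dotp a x + alpha * G x); pose m := mgf eta G a alpha.
have m_gt0 : 0 < m by exact: mgf_gt0.
have mp : measurable_fun [set: rVb] (p : rVb -> R).
  by apply: measurableT_comp => //; exact: measurable_affine.
have mE : \int[eta]_x p x = m by rewrite /Rintegral integral_expR_affine.
pose C := Num.max `|a| `|alpha| + 1.
have p_le x : p x <= expR ((C - 1) * abs_size x).
  by rewrite ler_expR /C addrK affine_le_abs_size// le_max lexx ?orbT.
have intM (f : 'rV[R]_h -> R) : measurable_fun [set: rVb] (f : rVb -> R) ->
    (forall x, `|f x| <= abs_size x) ->
    eta.-integrable [set: rVb] (EFin \o (fun x : rVb => f x * p x)).
  move=> mf fle; apply: (@le_expR_abs_size_integrable _ C).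
    exact: measurable_funM.
  move=> x; rewrite normrM (ger0_norm (expR_ge0 _)).
  rewrite -[X in expR (X * _)](subrKC 1 C) mulrDl mul1r.
  rewrite (expRD (abs_size x)) ler_pM ?expR_ge0//; last exact: p_le.
  by rewrite (le_trans (fle x))// (le_trans _ (expR_ge1Dx _))// lerDr.
have intx i : eta.-integrable [set: rVb] (EFin \o (fun x : rVb => x 0 i * p x)).
  apply: intM => // x; rewrite /abs_size (bigD1 i)//= -addrA lerDl addr_ge0//.
  by rewrite sumr_ge0.
have intG : eta.-integrable [set: rVb] (EFin \o (fun x : rVb => G x * p x)).
  by apply: intM => // x; rewrite /abs_size lerDr sumr_ge0.
have intp : eta.-integrable [set: rVb] (EFin \o (p : rVb -> R)).
  apply: (@le_expR_abs_size_integrable _ (C - 1)) => // x.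
  by rewrite ger0_norm ?expR_ge0.
pose b : 'rV[R]_h := \row_i (m^-1 * \int[eta]_x (x 0 i * p x)).
pose beta := m^-1 * \int[eta]_x (G x * p x).
have bE i : m * b 0 i = \int[eta]_x (x 0 i * p x).
  by rewrite mxE mulVKf ?gt_eqF.
have betaE : m * beta = \int[eta]_x (G x * p x) by rewrite mulVKf ?gt_eqF.
exists b, beta => a' alpha'; set v := dotp _ b + _.
pose V x := dotp (a' - a) x + (alpha' - alpha) * G x.
have intV1 : eta.-integrable [set: rVb]
    (EFin \o (fun x : rVb => \sum_i (a' - a) 0 i * (x 0 i * p x))).
  apply: (@eq_integrable _ _ _ _ _ measurableT
    (fun x : rVb => (\sum_i ((a' - a) 0 i)%:E * (x 0 i * p x)%:E)%E)).
    by move=> x _ /=; rewrite -sumEFin; apply: eq_bigr => i _; rewrite EFinM.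
  by apply: integrable_sum => // i _; apply: integrableZl => //; exact: intx.
have intV2 : eta.-integrable [set: rVb]
    (EFin \o (fun x : rVb => (alpha' - alpha) * (G x * p x))).
  exact: integrable_EFinZl.
have VpE x : V x * p x = \sum_i (a' - a) 0 i * (x 0 i * p x)
    + (alpha' - alpha) * (G x * p x).
  rewrite /V mulrDl mulrA; congr (_ + _).
  by rewrite mulr_suml; apply: eq_bigr => i _; rewrite mulrA.
have intV : eta.-integrable [set: rVb] (EFin \o (fun x : rVb => V x * p x)).
  apply: (@eq_integrable _ _ _ _ _ measurableT _ _ _ (integrableD measurableT intV1 intV2)).
  by move=> x _ /=; rewrite VpE.
have EV : \int[eta]_x (V x * p x) = m * v.
  under eq_Rintegral do rewrite VpE.
  rewrite RintegralD// Rintegral_sum; last first.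
    by move=> i; exact: integrable_EFinZl.
  rewrite RintegralZl// /v mulrDr /dotp mulr_sumr; congr (_ + _).
    by apply: eq_bigr => i _; rewrite RintegralZl// [in RHS]mulrCA bE.
  by rewrite mulrCA betaE.
have eV x : p x * expR (V x) = expR (dotp a' x + alpha' * G x).
  rewrite -expRD; congr expR.
  by rewrite /V dotpDl dotpNl; ring.
have intE : eta.-integrable [set: rVb]
    (EFin \o (fun x : rVb => p x * expR (V x))).
  under eq_fun do rewrite eV.
  apply: (@le_expR_abs_size_integrable _ (Num.max `|a'| `|alpha'|)).
    by apply: measurableT_comp => //; exact: measurable_affine.
  move=> x; rewrite ger0_norm ?expR_ge0// ler_expR.
  by apply: affine_le_abs_size; rewrite le_max lexx ?orbT.
have intvp : eta.-integrable [set: rVb]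
    (EFin \o (fun x : rVb => (1 - v) * p x)).
  exact: integrable_EFinZl.
have intD : eta.-integrable [set: rVb]
    (EFin \o (fun x : rVb => V x * p x + (1 - v) * p x)).
  by apply: (@eq_integrable _ _ _ _ _ measurableT _ _ _
    (integrableD measurableT intV intvp)).
have intL : eta.-integrable [set: rVb]
    (EFin \o (fun x : rVb => expR v * (V x * p x + (1 - v) * p x))).
  exact: integrable_EFinZl.
have -> : m * expR v
    = \int[eta]_x (expR v * (V x * p x + (1 - v) * p x)).
  by rewrite RintegralZl// RintegralD// RintegralZl// EV mE; ring.
have -> : mgf eta G a' alpha' = \int[eta]_x (p x * expR (V x)).
  by rewrite /mgf; congr fine; apply: eq_integral => x _; rewrite eV.
apply: le_Rintegral => // x _.
rewrite -mulrDl mulrA [leLHS]mulrC; apply: ler_wpM2l; first exact: expR_ge0.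
rewrite -[X in _ <= expR X](subrKC v) (expRD v (V x - v)).
apply: ler_wpM2l.
  exact: expR_ge0.
by apply: le_trans (expR_ge1Dx _); lra.
Qed.

(** At a subgradient [(b, beta)] of [H] at [(- a, - s)] the supremum defining the
    Legendre transform is attained at [(- a, - s)], so that the Hamiltonian at
    [(b, beta)] is at most [- H (- a, - s) - H_1 a]. *)
Lemma Isaacs_mgf_le (r s : R) (a : 'rV[R]_h) :
  (0 <= r%:E + ereal_inf [set Hamiltonian eta G s a p.1 p.2
                         | p in [set: 'rV[R]_h * R]])%E ->
  mgf eta G (- a) (- s) * mgf eta G a 0 <= expR r.
Proof.
move=> Isaacs; have [b [beta grad]] := mgf_gradient_le (- a) (- s).
have m_gt0 := mgf_gt0 cG finH (- a) (- s).
have m1_gt0 := mgf_gt0 cG finH a 0.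
have leL : (Legendre eta G b beta
    <= (- (dotp a b + s * beta) - ln (mgf eta G (- a) (- s)))%:E)%E.
  apply: ub_ereal_sup => _ [[a' alpha'] _ <-] /=.
  have m'_gt0 := mgf_gt0 cG finH a' alpha'.
  rewrite (logmgfE cG finH) -EFinB lee_fin.
  have := grad a' alpha'.
  move: (mgf eta G (- a) (- s)) (mgf eta G a' alpha') m_gt0 m'_gt0 => m m' m0 m'0.
  rewrite -(ler_ln _ m'0); last by rewrite posrE mulr_gt0 ?expR_gt0.
  rewrite (lnM m0) ?posrE ?expR_gt0// expRK !opprK dotpDl.
  by move: (ln m) (ln m') => u v; lra.
have : (0 <= r%:E + Hamiltonian eta G s a b beta)%E.
  apply: (le_trans Isaacs); rewrite leeD2l//; apply: ereal_inf_lbound.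
  by exists (b, beta).
rewrite /Hamiltonian /logmgf1 (logmgfE cG finH).
move: (mgf eta G (- a) (- s)) (mgf eta G a 0) m_gt0 m1_gt0 leL => m m1 m0 m10.
case: (Legendre _ _ _ _) => [l||] //.
rewrite lee_fin => lel; rewrite -EFinN -!EFinD lee_fin => le0.
by rewrite -(lnK m0) -(lnK m10) -expRD ler_expR; lra.
Qed.

End Duality.

(** * Weighted processes driven by conditional densities *)

Section History.
Context {R : realType} {d d' : measure_display} {Omega : measurableType d}
  {T : measurableType d'}.
Variables (P : probability Omega R) (X : nat -> {RV P >-> T}).

(** Measurability with respect to the first [j] samples. *)
Definition history_fun d1 (T1 : measurableType d1) (j : nat) (f : Omega -> T1) :=
  forall C, measurable C -> history X j (f @^-1` C).

(** The generators of [history X j], named so that [Omega] with this sigma-algebra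
    is itself a measurable type and the measurability lemmas apply to it. *)
Definition past (j : nat) : set (set Omega) :=
  \bigcup_(i in [set i | (i < j)%N])
    preimage_set_system [set: Omega] (X i) measurable.

Definition pastType (j : nat) := g_sigma_algebraType (past j).

Lemma history_measurable j A : history X j A -> measurable A.
Proof.
apply: smallest_sub; first exact: sigma_algebra_measurable.
move=> _ [i ij [B mB <-]].
have mX : measurable_fun [set: Omega] (X i) by [].
exact: mX.
Qed.

Lemma history_leq i j A : (i <= j)%N -> history X i A -> history X j A.
Proof.
move=> ij; apply: sub_sigma_algebra2; apply: bigcup_sub => k ki.
by apply: (@bigcup_sup _ _ k) => //=; exact: leq_trans ij.
Qed.

Lemma history_funP d1 (T1 : measurableType d1) j (f : Omega -> T1) :
  history_fun j f <-> measurable_fun [set: pastType j] (f : pastType j -> T1).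
Proof.
split=> [hf _ C mC|mf C mC]; first by rewrite setTI; exact: hf.
by have := mf measurableT C mC; rewrite setTI.
Qed.

Lemma history_fun_measurable d1 (T1 : measurableType d1) j (f : Omega -> T1) :
  history_fun j f -> measurable_fun [set: Omega] f.
Proof. by move=> hf _ C mC; rewrite setTI; apply: (@history_measurable j); exact: hf. Qed.

Lemma history_fun_leq d1 (T1 : measurableType d1) i j (f : Omega -> T1) :
  (i <= j)%N -> history_fun i f -> history_fun j f.
Proof. by move=> ij hf C mC; apply: (history_leq ij); exact: hf. Qed.

Lemma history_fun_sample j : history_fun j.+1 (X j).
Proof.
move=> C mC; apply: sub_sigma_algebra; exists j => //=.
by exists C => //; rewrite setTI.
Qed.

Lemma history_fun_comp d1 d2 (T1 : measurableType d1) (T2 : measurableType d2)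
    j (g : T1 -> T2) (f : Omega -> T1) :
  measurable_fun [set: T1] g -> history_fun j f -> history_fun j (g \o f).
Proof.
by move=> mg hf C mC; apply: (hf (g @^-1` C)); rewrite -[X in measurable X]setTI; exact: mg.
Qed.

Lemma history_fun_pair d1 d2 (T1 : measurableType d1) (T2 : measurableType d2)
    j (f : Omega -> T1) (g : Omega -> T2) :
  history_fun j f -> history_fun j g -> history_fun j (fun w => (f w, g w)).
Proof.
by move=> /history_funP mf /history_funP mg; apply/history_funP; exact: measurable_fun_pair.
Qed.

Lemma history_fun_cst d1 (T1 : measurableType d1) j (c : T1) :
  history_fun j (fun _ => c).
Proof. by apply/history_funP; exact: measurable_cst. Qed.

End History.

Section ConditionalDensity.
Local Open Scope ereal_scope.
Context {R : realType} {d d' : measure_display} {Omega : measurableType d}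
  {T : measurableType d'}.
Variables (P : probability Omega R) (eta : probability T R).
Variables (X : nat -> {RV P >-> T}) (G : T -> R) (Y : nat -> Omega -> R) (n : nat).
Variables (q : nat -> R * T -> R).

(** A conditional law, given by its defining integrals over the events of the
    past. *)
Definition conditional_density : Prop :=
  forall j A B, (j < n)%N -> history X j A -> measurable B ->
  P (A `&` X j @^-1` B) =
  \int[P]_(w in A) \int[eta]_(x in B) (q j (Y j w, x))%:E.

Hypothesis mG : measurable_fun [set: T] G.
Hypothesis Y0 : forall w, Y 0%N w = 0%R.
Hypothesis YS :
  forall j w, (j < n)%N -> Y j.+1 w = (Y j w + n%:R^-1 * G (X j w))%R.
Hypothesis mq : forall j, measurable_fun [set: R * T] (q j).
Hypothesis q_ge0 : forall j z, (0 <= q j z)%R.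
Hypothesis qP : conditional_density.

Lemma history_fun_Y j : (j <= n)%N -> history_fun X j (Y j).
Proof.
elim: j => [_|j IHj jn].
  by rewrite (_ : Y 0 = fun=> 0%R); [exact: history_fun_cst|exact/funext].
rewrite (_ : Y j.+1 = (fun z : R * T => (z.1 + n%:R^-1 * G z.2)%R)
    \o (fun w => (Y j w, X j w))); last by apply/funext => w /=; rewrite YS.
apply: history_fun_comp.
  apply: measurable_funD => //; apply: measurable_funM => //.
  exact: measurableT_comp.
apply: history_fun_pair; last exact: history_fun_sample.
by apply: history_fun_leq (IHj (ltnW jn)).
Qed.

Section Weights.
Variables (ell : nat -> R * T -> R).
Hypothesis mell : forall j, measurable_fun [set: R * T] (ell j).
Hypothesis ell_ge0 : forall j z, (0 <= ell j z)%R.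

Definition weight (j : nat) (w : Omega) : R :=
  (\prod_(i < j) ell i (Y i w, X i w))%R.

Lemma weight_ge0 j w : (0 <= weight j w)%R.
Proof. exact: prodr_ge0. Qed.

Lemma weightS j w : weight j.+1 w = (weight j w * ell j (Y j w, X j w))%R.
Proof. by rewrite /weight big_ord_recr. Qed.

Lemma history_fun_weight j : (j <= n)%N -> history_fun X j (weight j).
Proof.
elim: j => [_|j IHj jn].
  rewrite (_ : weight 0 = fun=> 1%R); first exact: history_fun_cst.
  by apply/funext => w; rewrite /weight big_ord0.
rewrite (_ : weight j.+1 = (fun z : R * (R * T) => (z.1 * ell j z.2)%R)
    \o (fun w => (weight j w, (Y j w, X j w)))); last first.
  by apply/funext => w /=; rewrite weightS.
apply: history_fun_comp.
  by apply: measurable_funM => //; exact: measurableT_comp.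
apply: history_fun_pair; first exact: history_fun_leq (IHj (ltnW jn)).
apply: history_fun_pair; last exact: history_fun_sample.
by apply: history_fun_leq (history_fun_Y (ltnW jn)).
Qed.

Definition backward (j : nat) (Phi : R -> \bar R) (y : R) : \bar R :=
  \int[eta]_x (Phi (y + n%:R^-1 * G x)%R * (ell j (y, x) * q j (y, x))%:E).

Lemma measurable_backward_integrand j Phi : measurable_fun [set: R] Phi ->
  measurable_fun [set: R * T] (fun z : R * T =>
    Phi (z.1 + n%:R^-1 * G z.2)%R * (ell j z * q j z)%:E).
Proof.
move=> mPhi; apply: emeasurable_funM.
  apply: measurableT_comp => //; apply: measurable_funD => //.
  by apply: measurable_funM => //; exact: measurableT_comp.
by apply/measurable_EFinP; exact: measurable_funM.
Qed.

Lemma measurable_backward j Phi : measurable_fun [set: R] Phi ->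
  (forall y, 0 <= Phi y) -> measurable_fun [set: R] (backward j Phi).
Proof.
move=> mPhi Phi0.
have := measurable_backward_integrand j mPhi.
move=> /(@measurable_fun_fubini_tonelli_F _ _ _ _ _ eta); apply => z.
by rewrite mule_ge0// lee_fin mulr_ge0.
Qed.

Lemma backward_ge0 j Phi : (forall y, 0 <= Phi y) -> forall y, 0 <= backward j Phi y.
Proof.
by move=> Phi0 y; apply: integral_ge0 => x _; rewrite mule_ge0// lee_fin mulr_ge0.
Qed.

(** The state [(Y j, weight j)] is a function of the past, and [Y j.+1] and
    [weight j.+1] are functions of this state and of the next sample; the next
    sample is integrated out by disintegration. *)
Lemma expectation_backward j Phi : (j < n)%N -> measurable_fun [set: R] Phi ->
  (forall y, 0 <= Phi y) ->
  \int[P]_w (Phi (Y j.+1 w) * (weight j.+1 w)%:E) =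
  \int[P]_w (backward j Phi (Y j w) * (weight j w)%:E).
Proof.
move=> jn mPhi Phi0.
pose S w := (Y j w, weight j w).
have hS : history_fun X j S.
  apply: history_fun_pair; first exact: (history_fun_Y (ltnW jn)).
  exact: (history_fun_weight (ltnW jn)).
have mS := history_fun_measurable hS.
pose Sm := isMeasurableFun.Build _ _ _ _ _ mS.
pose S' := HB.pack_for {mfun Omega >-> (R * R)%type} S Sm.
(* the absolute value makes [f] nonnegative on the whole product *)
pose f (z : (R * R) * T) := Phi (z.1.1 + n%:R^-1 * G z.2)%R
  * (`|z.1.2| * ell j (z.1.1, z.2))%:E.
pose q' (z : (R * R) * T) := q j (z.1.1, z.2).
have m11 : measurable_fun [set: (R * R) * T] (fun z => z.1.1).
  exact: measurableT_comp.
have m12 : measurable_fun [set: (R * R) * T] (fun z => z.1.2).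
  exact: measurableT_comp.
have m112 : measurable_fun [set: (R * R) * T] (fun z => (z.1.1, z.2)).
  exact: measurable_fun_pair.
have mf : measurable_fun [set: (R * R) * T] f.
  apply: emeasurable_funM.
    apply: measurableT_comp => //; apply: measurable_funD => //.
    by apply: measurable_funM => //; exact: measurableT_comp.
  apply/measurable_EFinP; apply: measurable_funM.
    exact: measurableT_comp.
  exact: (measurableT_comp (mell j)).
have f0 z : 0 <= f z by rewrite /f mule_ge0// lee_fin mulr_ge0.
transitivity (\int[P]_w f (S' w, X j w)).
  apply: eq_integral => w _; rewrite /f /= ger0_norm ?weight_ge0// weightS YS//.
have mq' : measurable_fun [set: (R * R) * T] q' by exact: (measurableT_comp (mq j)).
have PE C B : measurable C -> measurable B ->
    P (S' @^-1` C `&` X j @^-1` B) =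
    \int[P]_(w in S' @^-1` C) \int[eta]_(x in B) (q' (S' w, x))%:E.
  by move=> mC mB; apply: qP => //; exact: hS.
apply: (eq_trans (ge0_integral_disintegration mq' (fun z => q_ge0 j _) PE mf f0)).
apply: eq_integral => w _; rewrite /backward muleC -ge0_integralZl_EFin//.
- apply: eq_integral => x _; rewrite /f /q' /= ger0_norm ?weight_ge0//.
  by rewrite muleCA -muleA -!EFinM mulrA.
- by move=> x _; rewrite mule_ge0// lee_fin mulr_ge0.
- by have /(measurable_fun_pair2 (Y j w)) := measurable_backward_integrand j mPhi.
- exact: weight_ge0.
Qed.

(** By [expectation_backward] the weighted mean of [U j] at time [j] is
    nonincreasing in [j]. *)
Lemma expectation_weight_le (U : nat -> R -> R) :
  (forall j, measurable_fun [set: R] (U j)) -> (forall j y, (0 <= U j y)%R) ->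
  (forall j y, (j < n)%N -> backward j (EFin \o U j.+1) y <= (U j y)%:E) ->
  \int[P]_w (U n (Y n w) * weight n w)%:E <= (U 0%N 0%R)%:E.
Proof.
move=> mU U0 Ustep.
have mUE j : measurable_fun [set: R] (EFin \o U j) by exact/measurable_EFinP.
have mbound j (F : R -> \bar R) : (j <= n)%N -> measurable_fun [set: R] F ->
    measurable_fun [set: Omega] (fun w => F (Y j w) * (weight j w)%:E).
  move=> jn mF; apply: emeasurable_funM.
    apply: measurableT_comp => //.
    exact: (history_fun_measurable (history_fun_Y jn)).
  apply/measurable_EFinP.
  exact: (history_fun_measurable (history_fun_weight jn)).
suff bound j : (j <= n)%N ->
    \int[P]_w ((U j (Y j w))%:E * (weight j w)%:E) <= (U 0%N 0%R)%:E.
  by have := bound n (leqnn n); under eq_integral do rewrite -EFinM.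
elim: j => [_|j IHj jn].
  under eq_integral do rewrite Y0 /weight big_ord0 mule1.
  by rewrite integral_cst//= probability_setT mule1.
apply: le_trans (IHj (ltnW jn)).
rewrite (expectation_backward jn (mUE j.+1)); last first.
  by move=> y; rewrite lee_fin.
apply: ge0_le_integral => //.
- move=> w _; rewrite mule_ge0 ?lee_fin ?weight_ge0//.
  by apply: backward_ge0 => y; rewrite lee_fin.
- apply: mbound; first exact: ltnW.
  by apply: measurable_backward => // y; rewrite lee_fin.
- exact: (mbound j (EFin \o U j) (ltnW jn) (mUE j)).
- by move=> w _; rewrite lee_wpmul2r ?lee_fin ?weight_ge0// Ustep.
Qed.

(** The backward operator of a process whose weights compensate its densities. *)
Definition translation_mean (Phi : R -> \bar R) (y : R) : \bar R :=
  \int[eta]_x Phi (y + n%:R^-1 * G x)%R.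

Lemma expectation_weight_translation (Phi : R -> \bar R) :
  (forall j z, (ell j z * q j z = 1)%R) ->
  measurable_fun [set: R] Phi -> (forall y, 0 <= Phi y) ->
  \int[P]_w (Phi (Y n w) * (weight n w)%:E) = iter n translation_mean Phi 0%R.
Proof.
move=> ellq mPhi Phi0.
have backwardE j F : backward j F = translation_mean F.
  apply/funext => y; apply: eq_integral => x _.
  by rewrite ellq mule1.
have iterP m : measurable_fun [set: R] (iter m translation_mean Phi) /\
    (forall y, 0 <= iter m translation_mean Phi y).
  elim: m => //= m [mm m0]; split.
    by rewrite -(backwardE 0%N); exact: measurable_backward.
  by move=> y; rewrite -(backwardE 0%N); exact: backward_ge0.
suff step j : (j <= n)%N -> \int[P]_w (Phi (Y n w) * (weight n w)%:E) =
    \int[P]_w (iter j translation_mean Phi (Y (n - j) w) * (weight (n - j) w)%:E).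
  rewrite (step n (leqnn n)) subnn.
  under eq_integral do rewrite Y0 /weight big_ord0 mule1.
  by rewrite integral_cst//= probability_setT mule1.
elim: j => [|j IHj] jn; first by rewrite subn0.
have [mj j0] := iterP j.
have njn : (n - j.+1 < n)%N by rewrite ltn_subrL (leq_trans _ jn).
by rewrite (IHj (ltnW jn)) -(subnSK jn) (expectation_backward njn mj j0) backwardE.
Qed.

End Weights.
End ConditionalDensity.

(** * Independent samples *)

Section IidDensity.
Local Open Scope ereal_scope.
Context {R : realType} {d d' : measure_display} {Omega : measurableType d}
  {T : measurableType d'}.
Variables (P : probability Omega R) (eta : probability T R).
Variables (X : nat -> {RV P >-> T}).
Hypothesis iidX : iid X eta.

Let mX i B : measurable B -> measurable (X i @^-1` B).
Proof.
move=> mB; have mXi : measurable_fun [set: Omega] (X i) by [].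
by rewrite -[X in measurable X]setTI; exact: mXi.
Qed.

Let PX i B : measurable B -> P (X i @^-1` B) = eta B.
Proof. by move=> mB; have [/(_ i B mB)] := iidX. Qed.

(** Cylinder sets form a pi-system generating the past, and on them the product
    rule is the independence of finitely many samples. *)
Lemma iid_independent_past j A B : history X j A -> measurable B ->
  P (A `&` X j @^-1` B) = P A * eta B.
Proof.
move=> hA mB.
pose cyl (C : nat -> set T) := \bigcap_(i in [set` iota 0 j]) X i @^-1` C i.
pose Cyl := [set cyl C | C in [set C : nat -> set T | forall i, measurable (C i)]].
have mcyl C : (forall i, measurable (C i)) -> measurable (cyl C).
  by move=> mC; apply: fin_bigcap_measurable => // i _; exact: mX.
have etaB_fin : eta B \is a fin_num by exact: fin_num_measure.
have etaB_ge0 : (0 <= fine (eta B))%R by rewrite fine_ge0.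
pose m1 := mrestr P (mX j mB).
pose m2 := mscale (NngNum etaB_ge0) P.
suff : m1 A = m2 A.
  by rewrite /m1 /m2 /mrestr /mscale /= fineK// muleC.
apply: (@g_sigma_algebra_measure_unique _ _ _ Cyl _ (fun=> setT)) => //.
- by move=> _ [C mC <-]; exact: mcyl.
- by move=> _; exists (fun=> setT) => //; rewrite /cyl; apply/seteqP; split.
- by rewrite bigcup_const.
- move=> _ _ [C mC <-] [D mD <-]; exists (fun i => C i `&` D i).
    by move=> i; exact: measurableI.
  rewrite /cyl; apply/seteqP; split=> [w CD|w [Cw Dw] i ij].
    by split=> i ij; have [] := CD i ij.
  by split; [exact: Cw|exact: Dw].
- move=> _ [C mC <-].
  rewrite -[LHS]/(P (cyl C `&` X j @^-1` B)).
  rewrite -[RHS]/((fine (eta B))%:E * P (cyl C)) fineK//.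
  (* the cylinder and the event of the next sample form one longer cylinder *)
  pose C' i := if i == j then B else C i.
  have mC' i : measurable (C' i) by rewrite /C'; case: ifP.
  have jNj : j \notin iota 0 j by rewrite mem_iota ltnn andbF.
  have C'E i : i \in iota 0 j -> C' i = C i.
    by rewrite /C'; case: eqP => // -> /(negP jNj).
  have C'j : C' j = B by rewrite /C' eqxx.
  have [_ indX] := iidX.
  have := indX (j :: iota 0 j) C'; rewrite /= jNj iota_uniq => /(_ isT mC').
  rewrite big_cons C'j PX//.
  have := indX (iota 0 j) C (iota_uniq _ _) mC.
  rewrite -/(cyl C) => -> PE; rewrite (_ : cyl C `&` _ =
      \bigcap_(i in [set` j :: iota 0 j]) X i @^-1` C' i).
    rewrite PE; congr (_ * _); apply: eq_big_seq => i ij; rewrite C'E//.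
  apply/seteqP; split=> [w [Cw Bw] i /=|w Cw].
    rewrite inE => /orP[/eqP ->|ij]; first by rewrite C'j.
    by rewrite C'E//; exact: Cw.
  split=> [i ij|].
    by rewrite -C'E//; apply: Cw; rewrite /= inE ij orbT.
  by have := Cw j; rewrite C'j; apply; rewrite /= inE eqxx.
- move=> k; rewrite -[X in X < _]/(P (setT `&` X j @^-1` B)).
  apply: le_lt_trans (ltry 1); apply: probability_le1.
  by rewrite setTI; exact: mX.
- apply: sub_sigma_algebra2 hA => _ [i ij [D mD <-]]; rewrite setTI.
  exists (fun k => if k == i then D else setT) => [k|]; first by case: ifP.
  apply/seteqP; split=> [w /(_ i)/=|w Dw k _ /=].
    by rewrite eqxx mem_iota add0n; exact.
  by case: eqP => // ->.
Qed.

Lemma iid_conditional_density (Y : nat -> Omega -> R) n :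
  conditional_density eta X Y n (fun _ _ => 1%R).
Proof.
move=> j A B jn hA mB; rewrite iid_independent_past//.
under eq_integral do rewrite integral_cst// mul1e.
rewrite integral_cst//; first by rewrite muleC.
exact: history_measurable hA.
Qed.

End IidDensity.

(** * The sampling scheme *)

Lemma measurable_fun_integral_section d1 d2 (T1 : measurableType d1)
    (T2 : measurableType d2) (R : realType)
    (m : {sigma_finite_measure set T2 -> \bar R}) (f : T1 * T2 -> \bar R)
    (B : set T2) :
  measurable_fun [set: T1 * T2] f -> (forall z, (0 <= f z)%E) ->
  measurable B -> measurable_fun [set: T1] (fun s => \int[m]_(x in B) f (s, x))%E.
Proof.
move=> mf f0 mB.
rewrite (_ : (fun _ => _) = fubini_F m (f \_ ([set: T1] `*` B))); last first.
  apply/funext => s; rewrite [LHS]integral_mkcond; apply: eq_integral => x _.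
  by rewrite !patchE in_setX in_setT.
apply: measurable_fun_fubini_tonelli_F.
  apply/(measurable_restrictT _ _).1; first exact: measurableX.
  exact: measurable_funTS.
by move=> z; rewrite patchE; case: ifPn.
Qed.

Section SchemeDensity.
Context {R : realType} {h : nat}.
Local Notation rVb := (borel_rV R h).
Variables (eta : probability rVb R) (G : 'rV[R]_h -> R).
Hypothesis cG : continuous G.
Hypothesis finH : forall a alpha, (logmgf eta G a alpha < +oo)%E.
Context {K : nat}.
Variables (rho : 'I_K -> R -> R -> R) (abar : 'I_K -> R -> R -> 'rV[R]_h).
Hypothesis rho_ge0 : forall k y t, 0 <= t <= 1 -> 0 <= rho k y t.
Hypothesis rho_sum1 : forall y t, 0 <= t <= 1 -> \sum_(k < K) rho k y t = 1.
Hypothesis crho : forall k t, 0 <= t <= 1 -> continuous (rho k ^~ t).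
Hypothesis cabar : forall k t, 0 <= t <= 1 -> continuous (abar k ^~ t).

(** The minimum makes the densities below meaningful for every [j], also beyond
    the last step. *)
Definition grid (n j : nat) : R := Num.min (j%:R / n%:R) 1.

Lemma grid_itv n j : 0 <= grid n j <= 1.
Proof. by rewrite /grid le_min divr_ge0//= ler01 ge_min lexx orbT. Qed.

Lemma gridE n j : (j <= n)%N -> grid n j = j%:R / n%:R.
Proof.
move=> jn; apply: min_l; case: n jn => [|n] jn; first by rewrite invr0 mulr0.
by rewrite ler_pdivrMr ?ltr0n// mul1r ler_nat.
Qed.

Definition step_density (n j : nat) (z : R * rVb) : R :=
  \sum_(k < K) rho k z.1 (grid n j)
    * tilt_density eta G (abar k z.1 (grid n j)) z.2.

Lemma step_density_gt0 n j z : 0 < step_density n j z.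
Proof.
have tI := grid_itv n j.
have [k kP] : exists k, 0 < rho k z.1 (grid n j).
  apply/not_existsP => rho0; have := rho_sum1 z.1 tI.
  rewrite big1 => [/eqP|k _]; first by rewrite eq_sym oner_eq0.
  by apply/eqP; rewrite eq_le rho_ge0// andbT leNgt; apply/negP/rho0.
rewrite /step_density (bigD1 k)//= ltr_pwDl//.
  by rewrite mulr_gt0// expR_gt0.
by apply: sumr_ge0 => i _; rewrite mulr_ge0 ?rho_ge0// expR_ge0.
Qed.

Let mrho k n j : measurable_fun [set: R] (fun y => rho k y (grid n j)).
Proof. by apply: continuous_measurable_fun; exact: (crho (grid_itv n j)). Qed.

Let mabar k n j :
  measurable_fun [set: R] ((fun y => abar k y (grid n j)) : R -> rVb).
Proof.
by apply: measurable_borel_rV_continuous; exact: (cabar (grid_itv n j)).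
Qed.

Let mtilt k n j : measurable_fun [set: R * rVb]
  (fun z => tilt_density eta G (abar k z.1 (grid n j)) z.2).
Proof.
by apply: measurable_tilt_density => //; apply: (measurableT_comp (mabar k n j)).
Qed.

Lemma measurable_step_density n j :
  measurable_fun [set: R * rVb] (step_density n j).
Proof.
apply: measurable_sum => k; apply: measurable_funM; last exact: mtilt.
exact: (measurableT_comp (mrho k n j)).
Qed.

(** Summation over the values of the index: on each of them the sample has the
    tilted law, and the conditional probability of the value is [rho]. *)
Lemma scheme_conditional_density d (Omega : measurableType d)
    (P : probability Omega R) n (X : nat -> {RV P >-> rVb})
    (I : nat -> Omega -> 'I_K) (Y : nat -> Omega -> R) :
  sampling_scheme eta G rho abar n X I Y ->
  conditional_density eta X Y n (step_density n).
Proof.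
move=> scheme j A B jn hA mB.
have mA := history_measurable hA.
have gE : grid n j = j%:R / n%:R by rewrite gridE// ltnW.
have hY : history_fun X j (Y j).
  apply: (history_fun_Y _ (ss_Y0 scheme) (ss_YS scheme) (ltnW jn)).
  exact: measurable_continuous_borel_rV.
have mIk k : measurable (I j @^-1` [set k]) := ss_I_measurable scheme k jn.
have mXB : measurable (X j @^-1` B).
  have mXj : measurable_fun [set: Omega] (X j) by [].
  by rewrite -[Z in measurable Z]setTI; exact: mXj.
pose tl k y := (\int[eta]_(x in B) (tilt_density eta G (abar k y (grid n j)) x)%:E)%E.
have tl_ge0 k y : (0 <= tl k y)%E.
  by apply: integral_ge0 => x _; rewrite lee_fin expR_ge0.
have mtl k : measurable_fun [set: R] (tl k).
  apply: (@measurable_fun_integral_section _ _ _ _ _ eta (fun z : R * rVb =>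
    (tilt_density eta G (abar k z.1 (grid n j)) z.2)%:E)) => //.
    by apply/measurable_EFinP; exact: mtilt.
  by move=> z; rewrite lee_fin expR_ge0.
have mYj : measurable_fun [set: Omega] (Y j) := history_fun_measurable hY.
(* [Omega] with the sigma-algebra of the past, as the state to condition on *)
pose idP (w : Omega) : pastType X j := w.
have midP : measurable_fun [set: Omega] idP.
  by move=> _ C mC; rewrite setTI; exact: history_measurable mC.
pose S := HB.pack_for {mfun Omega >-> pastType X j} idP
  (isMeasurableFun.Build _ _ _ _ _ midP).
have /history_funP mYpast := hY.
have mA1 : measurable_fun [set: pastType X j] (fun w => (\1_A w)%:E : \bar R).
  by apply/measurable_EFinP; exact: measurable_indic.
have stepk k : (P ((A `&` X j @^-1` B) `&` I j @^-1` [set k]) =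
    \int[P]_(w in A) ((rho k (Y j w) (grid n j))%:E * tl k (Y j w)))%E.
  rewrite setIAC (ss_X scheme k jn hA mB).
  transitivity (\int[P]_(w in I j @^-1` [set k]) (tl k (Y j w) * (\1_A w)%:E))%E.
    rewrite setIC integral_mkcondr; apply: eq_integral => w _.
    by rewrite epatch_indic -gE.
  transitivity (\int[P]_w (tl k (Y j (S w)) * (\1_A (S w))%:E
      * (rho k (Y j (S w)) (grid n j))%:E))%E.
    apply: (@ge0_integral_event_density _ _ _ _ _ P S (I j @^-1` [set k])
      (fun w => rho k (Y j w) (grid n j)) (mIk k)
      _ _ _ (fun w => (tl k (Y j w) * (\1_A w)%:E)%E)).
    - exact: (measurableT_comp (mrho k n j)).
    - by move=> w; rewrite rho_ge0// grid_itv.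
    - by move=> C mC; rewrite gE; exact: (ss_I scheme k jn mC).
    - by apply: emeasurable_funM => //; exact: (measurableT_comp (mtl k)).
    - by move=> w; rewrite mule_ge0// lee_fin.
  rewrite [RHS]integral_mkcond; apply: eq_integral => w _.
  by rewrite epatch_indic /= muleAC (muleC (tl k _)).
have -> : (P (A `&` X j @^-1` B) =
    \sum_(k < K) P ((A `&` X j @^-1` B) `&` I j @^-1` [set k]))%E.
  rewrite -measure_bigsetU_ord//.
  - congr (P _); rewrite -bigcup_seq; apply/seteqP; split=> [w ABw|w].
      by exists (I j w) => //=; rewrite mem_index_enum.
    by move=> [k _ []].
  - by move=> k; apply: measurableI => //; exact: measurableI.
  - apply/trivIsetP => k l _ _ kl; apply/seteqP; split=> // w.
    by move=> [[_ /= ->] [_ /= /eqP]]; rewrite (negbTE kl).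
under eq_bigr do rewrite stepk.
rewrite -ge0_integral_sum//; last 2 first.
- move=> k; apply: measurable_funTS; apply: emeasurable_funM.
    by apply/measurable_EFinP; exact: (measurableT_comp (mrho k n j)).
  exact: (measurableT_comp (mtl k)).
- by move=> k w _; rewrite mule_ge0// lee_fin rho_ge0// grid_itv.
apply: eq_integral => w _.
rewrite /step_density; under [RHS]eq_integral do rewrite -sumEFin.
rewrite ge0_integral_sum//.
- apply: eq_bigr => k _; rewrite -ge0_integralZl_EFin//.
  + by move=> x _; rewrite lee_fin expR_ge0.
  + apply/measurable_funTS/measurable_EFinP.
    exact: (measurable_fun_pair2 (Y j w) (mtilt k n j)).
  + by rewrite rho_ge0// grid_itv.
- move=> k; apply/measurable_funTS/measurable_EFinP; apply: measurable_funM.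
    exact: (measurable_cst (rho k (Y j w) (grid n j))).
  exact: (measurable_fun_pair2 (Y j w) (mtilt k n j)).
- by move=> k x _; rewrite lee_fin mulr_ge0 ?expR_ge0// rho_ge0// grid_itv.
Qed.

End SchemeDensity.

(** * Calculus on the strip *)

Section StripCalculus.
Context {R : realType}.

Lemma continuous_on_strip_slice (V : topologicalType) (f : R -> R -> V) (t : R) :
  0 <= t <= 1 -> continuous_on_strip f -> continuous (f ^~ t).
Proof.
move=> t01 /subspace_continuousP cf y.
have cpair : (fun y' => (y', t)) @ y --> within strip (nbhs (y, t)).
  move=> A nA; have cp : (fun y' => (y', t)) @ y --> (y, t).
    exact: (@cvg_pair _ _ _ _ (nbhs y) (nbhs t) _ _ _ id (fun=> t) cvg_id (cvg_cst t)).
  have nyA : nbhs y [set y' | strip (y', t) -> A (y', t)] := cp _ nA.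
  suff : nbhs y [set y' | A (y', t)] by [].
  by apply: filterS nyA => y'; apply; rewrite /strip /=.
exact: (cvg_comp _ _ cpair (cf (y, t) t01)).
Qed.

Lemma continuous_on_strip_dist (f : R -> R -> R) (y t e : R) :
  continuous_on_strip f -> 0 <= t <= 1 -> 0 < e ->
  exists2 r, 0 < r & forall y' t', 0 <= t' <= 1 ->
    `|y' - y| < r -> `|t' - t| < r -> `|f y' t' - f y t| < e.
Proof.
move=> /subspace_continuousP cf t01 e0.
have /cvgrPdist_lt/(_ e e0) := cf (y, t) t01.
rewrite /= => /nbhs_ballP[r /= r0 rP]; exists r => // y' t' t'01 yr tr.
rewrite distrC; apply: (rP (y', t')) => //.
by split; rewrite /ball/= distrC.
Qed.

(** Only the first point is confined to the compact set: the second one may leave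
    it in the space direction, where it still belongs to the strip. *)
Lemma continuous_on_strip_unif (f : R -> R -> R) (B e : R) :
  continuous_on_strip f -> 0 < e ->
  exists2 r, 0 < r & forall y t y' t', `|y| <= B -> 0 <= t <= 1 ->
    0 <= t' <= 1 -> `|y' - y| <= r -> `|t' - t| <= r ->
    `|f y' t' - f y t| <= e.
Proof.
move=> cf e0.
pose Kb : set (R * R) := `[- B, B] `*` `[0, 1].
have cK : compact Kb by apply: compact_setX; exact: segment_compact.
(* the property of the radius [r] at [p] to be propagated by compactness *)
pose Q (r : R) (p : R * R) := 0 < r -> Kb p -> forall y' t', 0 <= t' <= 1 ->
    `|y' - p.1| <= r -> `|t' - p.2| <= r -> `|f y' t' - f p.1 p.2| <= e.
have /compact_near_coveringP := cK.
move=> /(_ R (0^'+) Q _)[].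
  move=> [y t] [/= _]; rewrite in_itv /= => t01.
  have [r r0 rP] := continuous_on_strip_dist y cf t01 (divr_gt0 e0 (ltr0n R 2)).
  have r20 : 0 < r / 2 by rewrite divr_gt0.
  exists (ball (y, t) (r / 2), [set s | s < r / 2]) => /=.
    split; first exact: nbhsx_ballx.
    by apply: nbhs_right_lt.
  move=> [[y1 t1] s] /= [[+ +] sr] s0 [/= _].
  rewrite /ball /= => y1r t1r; rewrite in_itv /= => t101 y' t' t'01 yr tr.
  have d1 : `|f y1 t1 - f y t| < e / 2.
    by apply: rP => //; rewrite distrC (lt_le_trans y1r _, lt_le_trans t1r _); lra.
  have d2 : `|f y' t' - f y t| < e / 2.
    apply: rP => //.
      rewrite (_ : y' - y = (y' - y1) - (y - y1)); last by ring.
      by apply: le_lt_trans (ler_normB _ _) _; lra.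
    rewrite (_ : t' - t = (t' - t1) - (t - t1)); last by ring.
    by apply: le_lt_trans (ler_normB _ _) _; lra.
  rewrite (_ : f y' t' - _ = (f y' t' - f y t) - (f y1 t1 - f y t)); last by ring.
  by apply: le_trans (ler_normB _ _) _; lra.
move=> r /= r0 rP; pose s := r / 2.
have s0 : 0 < s by rewrite divr_gt0.
exists s => // y t y' t' yB t01 t'01 yy' tt'.
have Kyt : Kb (y, t) by split; rewrite /= in_itv /= -?ler_norml.
have rs : ball 0 r s by rewrite /ball/= sub0r normrN gtr0_norm// /s; lra.
exact: (rP s rs s0 (y, t) Kyt s0 Kyt).
Qed.

Section C1.
Variables (W Wt DW : R -> R -> R).
Hypothesis C1 : continuously_differentiable W Wt DW.

Lemma space_mean_value (y y' t : R) : 0 <= t <= 1 ->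
  exists2 xi, `|xi - y| <= `|y' - y| &
    W y' t - W y t = DW xi t * (y' - y).
Proof.
move=> t01.
have dW x : is_derive x (1 : R) (W ^~ t) (DW x t) := cd_DW C1 x t01.
have cW : continuous (W ^~ t).
  by move=> x; apply/differentiable_continuous/derivable1_diffP; case: (dW x).
have mv a b : a <= b -> exists2 xi, a <= xi <= b &
    W b t - W a t = DW xi t * (b - a).
  move=> ab; have [|xi xiab E] := @MVT_segment _ (W ^~ t) (DW ^~ t) a b ab (fun x _ => dW x).
    exact: continuous_subspaceT.
  by exists xi => //; rewrite in_itv in xiab.
have [yy'|/ltW y'y] := leP y y'.
  have [xi /andP[xi1 xi2] E] := mv _ _ yy'; exists xi => //.
  by rewrite !ger0_norm ?subr_ge0// lerB.
have [xi /andP[xi1 xi2] E] := mv _ _ y'y; exists xi.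
  by rewrite ler0_norm ?subr_le0// ler0_norm ?subr_le0// lerN2 lerB.
by rewrite -opprB E; ring.
Qed.

Lemma time_quotient_dist (y t e : R) : 0 <= t <= 1 -> 0 < e ->
  exists2 r, 0 < r & forall u, 0 <= u <= 1 -> `|u - t| < r -> u != t ->
    `|Wt y t - (u - t)^-1 * (W y u - W y t)| < e.
Proof.
move=> t01 e0.
have /cvgrPdist_lt/(_ e e0) := @cd_Wt _ _ _ _ C1 y t t01.
rewrite /= => /nbhs_ballP[r /= r0 rP]; exists r => // u u01 ut nut.
apply: rP => //; first by rewrite /ball/= distrC.
Qed.

(** The derivative in time is one-sided at the ends of the unit interval, so that
    the mean value theorem is applied with a derivative inside and continuity up
    to the boundary. *)
Lemma time_mean_value (y t t' : R) : 0 <= t -> t <= t' -> t' <= 1 ->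
  exists2 tau, t <= tau <= t' &
    W y t' - W y t = Wt y tau * (t' - t).
Proof.
move=> t0 tt' t'1.
have dWt x : x \in `]t, t'[%R -> is_derive x (1 : R) (W y) (Wt y x).
  move=> /[!in_itv] /= /andP[tx xt'].
  have x01 : 0 <= x <= 1 by apply/andP; split; lra.
  have cvgd : (fun h : R => h^-1 *: ((W y \o shift x) (h *: 1) - W y x)) @ 0^'
      --> (Wt y x : R).
    apply/cvgrPdist_lt => e e0; have [r r0 rP] := time_quotient_dist y x01 e0.
    near=> h.
    have hx : h *: 1 + x = x + h by rewrite /GRing.scale /= mulr1 addrC.
    rewrite /= hx.
    have := rP (x + h); rewrite addrAC subrr add0r; apply.
    + apply/andP; split.
        suff : `|h| < x by rewrite ltr_norml => /andP[]; lra.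
        by near: h; apply: dnbhs0_lt; lra.
      suff : `|h| < 1 - x by rewrite ltr_norml => /andP[]; lra.
      by near: h; apply: dnbhs0_lt; lra.
    + by near: h; apply: dnbhs0_lt.
    + rewrite -subr_eq0 addrAC subrr add0r.
      by near: h; exact: nbhs_dnbhs_neq.
  by split; [apply/cvg_ex; exists (Wt y x)|exact: cvg_lim].
have cWt : {within `[t, t'], continuous (W y)}.
  apply/subspace_continuousP => x; rewrite /= in_itv /= => /andP[tx xt'].
  have x01 : 0 <= x <= 1 by apply/andP; split; lra.
  apply/cvgrPdist_lt => e e0.
  have [r r0 rP] := time_quotient_dist y x01 ltr01.
  pose D := `|Wt y x| + 1.
  have D0 : 0 < D by rewrite ltr_pwDr.
  apply/nbhs_ballP; exists (Num.min r (e / D)) => /=.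
    by rewrite lt_min r0 divr_gt0.
  move=> u; rewrite /ball /= lt_min => /andP[ur ue]; rewrite in_itv /= => /andP[tu ut'].
  have [->|nux] := eqVneq u x; first by rewrite subrr normr0.
  have ux0 : u - x != 0 by rewrite subr_eq0.
  have quot : `|(u - x)^-1 * (W y u - W y x)| <= D.
    have := rP u; rewrite distrC => /(_ _ ur nux) H.
    have /ltW {}H : `|Wt y x - (u - x)^-1 * (W y u - W y x)| < 1.
      by apply: H; apply/andP; split; lra.
    rewrite -[X in `|X|](subKr (Wt y x)).
    by apply: le_trans (ler_normB _ _) _; rewrite /D lerD2l.
  rewrite distrC -[X in `|X|](mulVKf ux0) normrM.
  apply: (@le_lt_trans _ _ (`|u - x| * D)); first by rewrite ler_wpM2l.
  by rewrite -ltr_pdivlMr// distrC.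
have [x xt E] := MVT_segment tt' dWt cWt.
by exists x => //; rewrite in_itv in xt.
Unshelve. all: by end_near. Qed.

End C1.

End StripCalculus.

(** * One step of the subsolution *)

(** Jensen's inequality, from the tangent of the exponential at the mean. *)
Lemma expR_convex_sum (R : realType) (K : nat) (p z : 'I_K -> R) :
  (forall k, 0 <= p k) -> \sum_k p k = 1 ->
  expR (\sum_k p k * z k) <= \sum_k p k * expR (z k).
Proof.
move=> p0 p1; set m := \sum_k p k * z k.
have : \sum_k p k * (expR m * (1 + (z k - m))) <= \sum_k p k * expR (z k).
  apply: ler_sum => k _; rewrite ler_wpM2l//.
  by rewrite -[X in _ <= expR X](subrKC m) expRD ler_wpM2l ?expR_ge0// expR_ge1Dx.
apply: le_trans; rewrite le_eqVlt; apply/orP; left; apply/eqP.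
transitivity (expR m * (\sum_k p k + (\sum_k p k * z k - (\sum_k p k) * m))).
  by rewrite p1 mul1r -/m subrr addr0 mulr1.
rewrite mulr_suml -sumrB -big_split mulr_sumr; apply: eq_bigr => k _ /=; ring.
Qed.

(** Jensen's inequality twice: the mixture is at least the exponential of the mean
    exponent, and the exponential of a mean is at most the mean of exponentials. *)
Lemma inv_mixture_le (R : realType) (K : nat) (p u v : 'I_K -> R) :
  (forall k, 0 <= p k) -> \sum_k p k = 1 ->
  (\sum_k p k * expR (u k))^-1 * expR (- \sum_k p k * v k)
    <= \sum_k p k * expR (- u k - v k).
Proof.
move=> p0 p1; apply: le_trans (expR_convex_sum _ p0 p1).
under [in leRHS]eq_bigr do rewrite mulrDr 2!mulrN.
rewrite big_split /= 2!sumrN expRD ler_wpM2r ?expR_ge0// expRN.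
rewrite lef_pV2 ?posrE ?expR_gt0 ?expR_convex_sum//.
by rewrite (lt_le_trans _ (expR_convex_sum _ p0 p1)) ?expR_gt0.
Qed.

Section OneStep.
Context {R : realType} {h : nat}.
Local Notation rVb := (borel_rV R h).
Variables (eta : probability rVb R) (G : 'rV[R]_h -> R).
Hypothesis cG : continuous G.
Hypothesis finH : forall a alpha, (logmgf eta G a alpha < +oo)%E.
Context {K : nat}.
Variables (W : R -> R -> R)
  (rho : 'I_K -> R -> R -> R) (abar : 'I_K -> R -> R -> 'rV[R]_h)
  (Wt DW : R -> R -> R) (r s : 'I_K -> R -> R -> R).
Hypothesis sub : generalized_subsolution eta G W rho abar Wt DW r s.
Variable M : R.
Hypothesis M_ge0 : 0 <= M.
Hypothesis le_M : forall k (y t : R), 0 <= t <= 1 ->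
  [/\ `|r k y t| <= M, `|s k y t| <= M, `|rho k y t| <= M & `|abar k y t| <= M].

Lemma convex_combination_le (f : 'I_K -> R) (y t : R) : 0 <= t <= 1 ->
  (forall k, `|f k| <= M) -> `|\sum_k rho k y t * f k| <= M.
Proof.
move=> t01 fM; apply: (le_trans (ler_norm_sum _ _ _)).
rewrite -[leRHS]mul1r -(gs_rho_sum1 sub y t01) mulr_suml.
apply: ler_sum => k _; rewrite normrM ger0_norm ?(gs_rho_ge0 sub)//.
by rewrite ler_wpM2l// (gs_rho_ge0 sub).
Qed.

Lemma DW_le (y t : R) : 0 <= t <= 1 -> `|DW y t| <= M.
Proof.
move=> t01; rewrite (gs_DW sub y t01); apply: convex_combination_le => // k.
by have [] := le_M k y t01.
Qed.

Lemma Wt_le (y t : R) : 0 <= t <= 1 -> `|Wt y t| <= M.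
Proof.
move=> t01; rewrite (gs_Wt sub y t01); apply: convex_combination_le => // k.
by have [] := le_M k y t01.
Qed.

(** The increment is split into a move in space at the later time followed by a
    move in time at the starting position, so that both mean values are taken
    inside the strip. *)
Lemma scaled_increment (n : nat) (y t g : R) : (0 < n)%N ->
  0 <= t -> t + n%:R^-1 <= 1 ->
  exists2 xi, `|xi - y| <= n%:R^-1 * `|g| & exists2 tau, t <= tau <= t + n%:R^-1 &
    n%:R * (W (y + n%:R^-1 * g) (t + n%:R^-1) - W y t)
      = DW xi (t + n%:R^-1) * g + Wt y tau.
Proof.
move=> n0 t0 t1; have n0' : (0 : R) < n%:R by rewrite ltr0n.
have nN0 : n%:R != 0 :> R by rewrite gt_eqF.
have nV0 : (0 : R) <= n%:R^-1 by rewrite invr_ge0 ltW.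
have t'01 : 0 <= t + n%:R^-1 <= 1 by rewrite t1 addr_ge0.
have [xi xiy E] := space_mean_value (gs_C1 sub) y (y + n%:R^-1 * g) t'01.
have tt' : t <= t + n%:R^-1 by rewrite lerDl.
have [tau taut E'] := time_mean_value (gs_C1 sub) y t0 tt' t1.
exists xi.
  by move: xiy; rewrite addrAC subrr add0r normrM (ger0_norm nV0).
exists tau => //.
rewrite (_ : _ - _ = (W (y + n%:R^-1 * g) (t + n%:R^-1) - W y (t + n%:R^-1))
   + (W y (t + n%:R^-1) - W y t)); last by ring.
by rewrite E E'; field.
Qed.

Lemma growth_bound (y t : R) : 0 <= t <= 1 ->
  `|W y t| <= `|W 0 0| + M + M * `|y|.
Proof.
move=> /[dup] t01 /andP[t0 t1].
have [xi _ E] := space_mean_value (gs_C1 sub) 0 y t01.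
have [tau /andP[tau0 tau1] E'] := time_mean_value (gs_C1 sub) 0 (lexx 0) t0 t1.
rewrite (_ : W y t = W 0 0 + (W 0 t - W 0 0) + (W y t - W 0 t)); last by ring.
apply: (le_trans (ler_normD _ _)); rewrite E E' !subr0 lerD//.
  apply: (le_trans (ler_normD _ _)); rewrite lerD2l normrM (ger0_norm t0).
  rewrite -[leRHS]mulr1 ler_pM ?Wt_le//; apply/andP; split; lra.
by rewrite normrM ler_wpM2r// DW_le.
Qed.

(** A common bound for the moment generating functions of all the tilts used by
    the scheme, see [mgf_le_bound]. *)
Definition mgf_bound : R := fine (\int[eta]_x (expR (M * abs_size G x))%:E).

(** An integrable majorant, uniform in [n], [j] and [y], for everything that one
    step multiplies the potential by.  The rate [6 * M + 5] covers the inverse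
    density (rate [M]) times either the penalty (rate [4 * M + 4]) or the value
    (rate [M]), the latter with one unit to spare for the tail of [G]. *)
Definition exp_majorant (x : rVb) : R :=
  mgf_bound * expR M * expR ((6 * M + 5) * abs_size G x).

Definition majorant_mass : R := fine (\int[eta]_x (exp_majorant x)%:E).

(** The mixture that dominates the inverse density times the exponential of the
    linearized increment of [- W]. *)
Definition subsolution_kernel (t y : R) (x : rVb) : R :=
  \sum_(k < K) rho k y t *
    expR (- (dotp (abar k y t) x - ln (mgf eta G (abar k y t) 0))
          - (s k y t * G x + r k y t)).

Let mS : measurable_fun [set: rVb] (abs_size G : rVb -> R).
Proof. exact: measurable_abs_size. Qed.

Let mexpS (C : R) : measurable_fun [set: rVb]
  (fun x : rVb => (expR (C * abs_size G x))%:E).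
Proof. by apply/measurable_EFinP/measurableT_comp => //; exact: measurable_funM. Qed.

Lemma mgf_boundE : (\int[eta]_x (expR (M * abs_size G x))%:E = mgf_bound%:E)%E.
Proof.
rewrite /mgf_bound fineK// ge0_fin_numE; first exact: integral_expR_abs_size_lty.
by apply: integral_ge0 => x _; rewrite lee_fin expR_ge0.
Qed.

Lemma mgf_bound_ge0 : 0 <= mgf_bound.
Proof.
by rewrite -lee_fin -mgf_boundE; apply: integral_ge0 => x _; rewrite lee_fin expR_ge0.
Qed.

Lemma mgf_le_bound (a : 'rV[R]_h) : `|a| <= M -> mgf eta G a 0 <= mgf_bound.
Proof.
move=> aM; rewrite -lee_fin -mgf_boundE -(integral_expR_affine cG finH).
apply: ge0_le_integral => //.
- by apply/measurable_EFinP/measurableT_comp => //; exact: measurable_affine.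
- by move=> x _; rewrite lee_fin ler_expR affine_le_abs_size// normr0.
Qed.

Lemma exp_majorant_ge0 x : 0 <= exp_majorant x.
Proof. by rewrite /exp_majorant !mulr_ge0 ?expR_ge0 ?mgf_bound_ge0. Qed.

Lemma measurable_exp_majorant : measurable_fun [set: rVb] exp_majorant.
Proof.
apply: measurable_funM => //; apply: measurableT_comp => //.
exact: measurable_funM.
Qed.

Lemma majorant_massE : (\int[eta]_x (exp_majorant x)%:E = majorant_mass%:E)%E.
Proof.
rewrite /majorant_mass fineK// ge0_fin_numE; last first.
  by apply: integral_ge0 => x _; rewrite lee_fin exp_majorant_ge0.
under eq_integral do rewrite EFinM.
rewrite ge0_integralZl_EFin//; last by rewrite mulr_ge0 ?mgf_bound_ge0 ?expR_ge0.
by apply: lte_mul_pinfty; [rewrite lee_fin mulr_ge0 ?mgf_bound_ge0 ?expR_ge0|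
  |exact: integral_expR_abs_size_lty].
Qed.

Lemma majorant_mass_ge0 : 0 <= majorant_mass.
Proof.
by rewrite -lee_fin -majorant_massE; apply: integral_ge0 => x _; rewrite lee_fin exp_majorant_ge0.
Qed.

Section Fixed.
Variables (t y : R).
Hypothesis t01 : 0 <= t <= 1.

Let ucoef k (x : 'rV[R]_h) : R :=
  dotp (abar k y t) x - ln (mgf eta G (abar k y t) 0).

Let mixE (x : 'rV[R]_h) :
  \sum_(k < K) rho k y t * tilt_density eta G (abar k y t) x
  = \sum_(k < K) rho k y t * expR (ucoef k x).
Proof.
apply: eq_bigr => k _; congr (_ * _).
by rewrite /tilt_density /logmgf1 logmgfE.
Qed.

Let rho0 k : 0 <= rho k y t. Proof. exact: (gs_rho_ge0 sub). Qed.

Lemma inv_mixture_le_abs_size (x : 'rV[R]_h) :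
  (\sum_(k < K) rho k y t * tilt_density eta G (abar k y t) x)^-1
    <= mgf_bound * expR (M * abs_size G x).
Proof.
have := inv_mixture_le (ucoef ^~ x) (fun=> 0) rho0 (gs_rho_sum1 sub y t01).
have z0 : \sum_(k < K) rho k y t * 0 = 0 by apply: big1 => k _; rewrite mulr0.
rewrite -mixE z0 oppr0 expR0 mulr1 => /le_trans; apply.
rewrite -[leRHS]mul1r -(gs_rho_sum1 sub y t01) mulr_suml.
apply: ler_sum => k _; rewrite ler_wpM2l//= addr0 /ucoef opprB expRD lnK; last first.
  by rewrite posrE; exact: mgf_gt0.
have [_ _ _ aM] := le_M k y t01.
rewrite ler_pM ?expR_ge0 ?mgf_le_bound//; first exact/ltW/mgf_gt0.
rewrite ler_expR -dotpNl.
have := @affine_le_abs_size _ _ G (- abar k y t) 0 M x.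
by rewrite mul0r addr0 normrN normr0; exact.
Qed.

Lemma inv_mixture_le_kernel (x : 'rV[R]_h) :
  (\sum_(k < K) rho k y t * tilt_density eta G (abar k y t) x)^-1
    * expR (- (DW y t * G x + Wt y t)) <= subsolution_kernel t y x.
Proof.
have := inv_mixture_le (ucoef ^~ x) (fun k => s k y t * G x + r k y t)
  rho0 (gs_rho_sum1 sub y t01).
rewrite -mixE; congr (_ * expR (- _) <= _).
rewrite (gs_DW sub y t01) (gs_Wt sub y t01) mulr_suml -big_split /=.
by apply: eq_bigr => k _; ring.
Qed.

Lemma kernel_ge0 x : 0 <= subsolution_kernel t y x.
Proof. by apply: sumr_ge0 => k _; rewrite mulr_ge0 ?expR_ge0. Qed.

Let JE k (x : 'rV[R]_h) : expR (- ucoef k x - (s k y t * G x + r k y t)) =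
  mgf eta G (abar k y t) 0 * expR (- r k y t) *
    expR (dotp (- abar k y t) x + (- s k y t) * G x).
Proof.
rewrite -[X in X * _ * _]lnK; last by rewrite posrE; exact: mgf_gt0.
by rewrite -!expRD dotpNl /ucoef; congr expR; ring.
Qed.

Lemma measurable_kernel : measurable_fun [set: rVb] (subsolution_kernel t y).
Proof.
apply: measurable_sum => k; apply: measurable_funM => //.
rewrite (_ : (fun _ => _) = (fun x : rVb => expR (- ucoef k x - (s k y t * G x + r k y t))))//.
under eq_fun do rewrite JE.
apply: measurable_funM => //; apply: measurableT_comp => //.
exact: measurable_affine.
Qed.

(** This is where the Isaacs inequality enters, separately for each [k]. *)
Lemma integral_kernel_le1 : (\int[eta]_x (subsolution_kernel t y x)%:E <= 1)%E.
Proof.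
have mexp k : measurable_fun [set: rVb] (fun x : rVb =>
    (expR (dotp (- abar k y t) x + (- s k y t) * G x))%:E).
  by apply/measurable_EFinP/measurableT_comp => //; exact: measurable_affine.
rewrite /subsolution_kernel; under eq_integral do rewrite -sumEFin.
under eq_integral do under eq_bigr do rewrite -/(ucoef _ _) JE mulrA EFinM.
have c0 k : 0 <= rho k y t * (mgf eta G (abar k y t) 0 * expR (- r k y t)).
  by rewrite !mulr_ge0 ?expR_ge0//; exact/ltW/mgf_gt0.
rewrite ge0_integral_sum//; last 2 first.
- by move=> k; apply: emeasurable_funM.
- by move=> k x _; rewrite mule_ge0 ?lee_fin ?expR_ge0.
under eq_bigr => k _.
  rewrite ge0_integralZl_EFin//.
  rewrite integral_expR_affine// -EFinM.
  over.
rewrite sumEFin lee_fin -(gs_rho_sum1 sub y t01).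
apply: ler_sum => k _; rewrite -mulrA -[leRHS]mulr1 ler_wpM2l//.
rewrite mulrAC [X in X * _]mulrC expRN ler_pdivrMr ?expR_gt0// mul1r.
exact: Isaacs_mgf_le (gs_Isaacs sub k y t01).
Qed.

Lemma integral_le_combination (f : rVb -> R) (c1 c2 : R) :
  measurable_fun [set: rVb] f -> 0 <= c1 -> 0 <= c2 ->
  (forall x, 0 <= f x) -> (forall x, f x <= c1 * subsolution_kernel t y x + c2 * exp_majorant x) ->
  (\int[eta]_x (f x)%:E <= (c1 + c2 * majorant_mass)%:E)%E.
Proof.
move=> mf c10 c20 f0 fle.
have mJE : measurable_fun [set: rVb] (fun x => (subsolution_kernel t y x)%:E).
  by apply/measurable_EFinP; exact: measurable_kernel.
have mPE : measurable_fun [set: rVb] (fun x => (exp_majorant x)%:E).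
  by apply/measurable_EFinP; exact: measurable_exp_majorant.
apply: (@le_trans _ _ (\int[eta]_x
  (c1%:E * (subsolution_kernel t y x)%:E + c2%:E * (exp_majorant x)%:E)))%E.
  apply: ge0_le_integral => //.
  - by move=> x _; rewrite lee_fin.
  - exact/measurable_EFinP.
  - by apply: emeasurable_funD; exact: emeasurable_funM.
  - by move=> x _; rewrite -!EFinM -EFinD lee_fin.
rewrite ge0_integralD//; last 4 first.
- by move=> x _; rewrite mule_ge0 ?lee_fin ?kernel_ge0.
- exact: emeasurable_funM.
- by move=> x _; rewrite mule_ge0 ?lee_fin ?exp_majorant_ge0.
- exact: emeasurable_funM.
rewrite !ge0_integralZl_EFin//; last 2 first.
- by move=> x _; rewrite lee_fin exp_majorant_ge0.
- by move=> x _; rewrite lee_fin kernel_ge0.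
rewrite majorant_massE EFinD EFinM leeD2r// -[leRHS]mule1 lee_wpmul2l ?lee_fin//.
exact: integral_kernel_le1.
Qed.

End Fixed.

End OneStep.

(** * A supersolution for the second moment *)

Section Potential.
Context {R : realType} {h : nat}.
Local Notation rVb := (borel_rV R h).
Variables (eta : probability rVb R) (G : 'rV[R]_h -> R).
Hypothesis cG : continuous G.
Hypothesis finH : forall a alpha, (logmgf eta G a alpha < +oo)%E.
Context {K : nat}.
Variables (W : R -> R -> R)
  (rho : 'I_K -> R -> R -> R) (abar : 'I_K -> R -> R -> 'rV[R]_h)
  (Wt DW : R -> R -> R) (r s : 'I_K -> R -> R -> R).
Hypothesis sub : generalized_subsolution eta G W rho abar Wt DW r s.
Variable M : R.
Hypothesis M_ge0 : 0 <= M.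
Hypothesis le_M : forall k (y t : R), 0 <= t <= 1 ->
  [/\ `|r k y t| <= M, `|s k y t| <= M, `|rho k y t| <= M & `|abar k y t| <= M].

Local Notation q := (step_density eta G rho abar).
Local Notation majorantM := (exp_majorant eta G M).
Local Notation massM := (majorant_mass eta G M).
Local Notation gridR := (@grid R).
Local Notation kernelM := (subsolution_kernel eta G rho abar r s).

Lemma gridS (n j : nat) : (j < n)%N -> gridR n j.+1 = gridR n j + n%:R^-1.
Proof.
move=> jn; rewrite !gridE//; last exact: ltnW.
by rewrite -addn1 natrD mulrDl mul1r.
Qed.

Section Step.
Variables (n j : nat) (y : R).
Hypothesis jn : (j < n)%N.
Let t := gridR n j.
Let t' := gridR n j.+1.
Let t01 : 0 <= t <= 1. Proof. exact: grid_itv. Qed.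
Let n_gt0 : (0 : R) < n%:R. Proof. by rewrite ltr0n (leq_ltn_trans _ jn). Qed.
Let n_neq0 : n%:R != 0 :> R. Proof. by rewrite gt_eqF. Qed.

Definition increment (g : R) : R :=
  n%:R * (W (y + n%:R^-1 * g) t' - W y t).

Let increment_mean g : exists2 xi, `|xi - y| <= n%:R^-1 * `|g| &
  exists2 tau, t <= tau <= t' & increment g = DW xi t' * g + Wt y tau.
Proof.
rewrite /increment /t' gridS//; apply: (scaled_increment sub).
- exact: leq_ltn_trans jn.
- by have /andP[] := t01.
- by rewrite -gridS//; have /andP[] := @grid_itv R n j.+1.
Qed.

Lemma increment_ge g : - increment g <= M * `|g| + M.
Proof.
have [xi _ [tau /andP[tau0 tau1] ->]] := increment_mean g.
have t'01 : 0 <= t' <= 1 by exact: grid_itv.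
have tau01 : 0 <= tau <= 1.
  by case/andP: t01 => ? _; case/andP: t'01 => _ ?; apply/andP; split; lra.
rewrite (le_trans (ler_norm _))// normrN (le_trans (ler_normD _ _))// lerD//.
  by rewrite normrM ler_wpM2r// (DW_le sub le_M).
exact: (Wt_le sub le_M).
Qed.

Let qE x : q n j (y, x) = \sum_(k < K) rho k y t * tilt_density eta G (abar k y t) x.
Proof. by []. Qed.

Let q_gt0 x : 0 < q n j (y, x).
Proof.
by apply: step_density_gt0; [exact: (gs_rho_ge0 sub)|exact: (gs_rho_sum1 sub)].
Qed.

Let S_ge0 x : 0 <= abs_size G x. Proof. exact: abs_size_ge0. Qed.
Let G_le_S x : `|G x| <= abs_size G x.
Proof. by rewrite /abs_size lerDr sumr_ge0. Qed.

Lemma expR_inv_density_le (b c : R) (x : rVb) :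
  b + M * abs_size G x <= c + M + (6 * M + 5) * abs_size G x ->
  expR b * (q n j (y, x))^-1 <= expR c * majorantM x.
Proof.
move=> bc; rewrite qE.
have := inv_mixture_le_abs_size cG finH sub M_ge0 le_M y t01 x.
move=> /(ler_wpM2l (expR_ge0 b)) /le_trans; apply.
rewrite mulrCA -expRD /exp_majorant -mulrA -expRD mulrCA -expRD.
by rewrite ler_wpM2l ?mgf_bound_ge0// ler_expR addrA.
Qed.

Lemma value_step_le_majorant (c : R) (x : rVb) :
  expR (c - n%:R * W (y + n%:R^-1 * G x) t') * (q n j (y, x))^-1
    <= expR (c - n%:R * W y t) * majorantM x.
Proof.
apply: expR_inv_density_le.
have := increment_ge (G x); rewrite /increment.
move: (G_le_S x) (S_ge0 x) => GS S0.
have := ler_wpM2l M_ge0 GS.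
have := mulr_ge0 M_ge0 S0.
by set a := n%:R * W y t; rewrite mulrBr -/a; nra.
Qed.

(** The spare unit in the rate of the majorant gains the factor [expR (- A)] where
    [`|G|] exceeds [A]. *)
Lemma value_step_tail (c A : R) (x : rVb) : A <= `|G x| ->
  expR (c - n%:R * W (y + n%:R^-1 * G x) t') * (q n j (y, x))^-1
    <= expR (c - n%:R * W y t) * (expR (- A) * majorantM x).
Proof.
move=> AG; rewrite mulrA -expRD; apply: expR_inv_density_le.
have := increment_ge (G x); rewrite /increment.
move: (G_le_S x) (S_ge0 x) => GS S0.
have := ler_wpM2l M_ge0 GS.
have := mulr_ge0 M_ge0 S0.
by set a := n%:R * W y t; rewrite mulrBr -/a; nra.
Qed.

Lemma penalty_step_le_majorant (c B : R) (x : rVb) :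
  expR (c + n%:R * ((4 * M + 4) * (`|y + n%:R^-1 * G x| - B))) * (q n j (y, x))^-1
    <= expR (c + n%:R * ((4 * M + 4) * (`|y| - B))) * majorantM x.
Proof.
apply: expR_inv_density_le.
have yg : n%:R * `|y + n%:R^-1 * G x| <= n%:R * `|y| + `|G x|.
  have -> : `|G x| = n%:R * (n%:R^-1 * `|G x|) by rewrite mulVKf.
  rewrite -mulrDr; apply: ler_wpM2l; first exact: ltW.
  by rewrite (le_trans (ler_normD _ _))// lerD2l normrM ger0_norm// invr_ge0 ltW.
move: (G_le_S x) (S_ge0 x) => GS S0.
have MS := mulr_ge0 M_ge0 S0.
have M0 := M_ge0.
have th0 : 0 <= 4 * M + 4 by lra.
have dS : n%:R * `|y + n%:R^-1 * G x| - n%:R * `|y| <= abs_size G x by lra.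
have H := ler_wpM2l th0 dS.
have E : n%:R * ((4 * M + 4) * (`|y + n%:R^-1 * G x| - B)) =
  n%:R * ((4 * M + 4) * (`|y| - B)) +
  (4 * M + 4) * (n%:R * `|y + n%:R^-1 * G x| - n%:R * `|y|) by ring.
rewrite E; lra.
Qed.

(** The hypothesis bounds the error of the linearization of [W] at [(y, t)]. *)
Lemma value_step_le_kernel (c e : R) (x : rVb) :
  (forall xi tau, `|xi - y| <= n%:R^-1 * `|G x| -> t <= tau <= t' ->
    `|(DW xi t' - DW y t) * G x + (Wt y tau - Wt y t)| <= e) ->
  expR (c - n%:R * W (y + n%:R^-1 * G x) t') * (q n j (y, x))^-1
    <= expR (c - n%:R * W y t) * (expR e * kernelM t y x).
Proof.
move=> dist; have [xi xiy [tau taut E]] := increment_mean (G x).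
have := inv_mixture_le_kernel cG finH sub y t01 x; rewrite -qE => qJ.
apply: (@le_trans _ _ (expR (c - n%:R * W y t) * (expR e *
   ((q n j (y, x))^-1 * expR (- (DW y t * G x + Wt y t)))))); last first.
  by rewrite !ler_wpM2l ?expR_ge0.
rewrite [X in _ * (_ * X)]mulrC !mulrA -!expRD; apply: ler_wpM2r.
  by rewrite invr_ge0 ltW.
rewrite ler_expR; have := dist xi tau xiy taut.
rewrite ler_norml => /andP[+ _].
move: E; rewrite /increment mulrBr.
by set a := n%:R * W y t; set b := n%:R * W _ _; lra.
Qed.

End Step.
Lemma measurable_inv_step_density n j :
  measurable_fun [set: R * rVb] (fun z => (q n j z)^-1).
Proof.
have crho k t : 0 <= t <= 1 -> continuous (rho k ^~ t).
  by move=> t01; apply: continuous_on_strip_slice => //; have [] := gs_continuous sub k.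
have cabar k t : 0 <= t <= 1 -> continuous (abar k ^~ t).
  by move=> t01; apply: continuous_on_strip_slice => //; have [] := gs_continuous sub k.
rewrite (_ : (fun _ => _) = (fun z => expR (- ln (q n j z)))); last first.
  apply/funext => z; rewrite expRN lnK// posrE.
  by apply: step_density_gt0; [exact: (gs_rho_ge0 sub)|exact: (gs_rho_sum1 sub)].
apply: measurableT_comp => //; apply: measurable_funN.
apply: measurableT_comp; first exact: measurable_ln.
exact: measurable_step_density.
Qed.

(** The weight of one step in the second moment. *)
Definition square_weight n j (z : R * rVb) : R := (q n j z)^-1 ^+ 2.

Lemma square_weightM n j z : square_weight n j z * q n j z = (q n j z)^-1.
Proof.
have q0 : 0 < q n j z.
  by apply: step_density_gt0; [exact: (gs_rho_ge0 sub)|exact: (gs_rho_sum1 sub)].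
by rewrite /square_weight expr2 -mulrA mulVf ?mulr1// gt_eqF.
Qed.

(** The first term is the value with a loss [e] per step; the second one takes
    over where [`|y|] is large.  Its slope exceeds twice the Lipschitz constant
    [M] of [W], and [L] pays for its growth over one step. *)
Definition potential (n : nat) (e L B : R) (j : nat) (y : R) : R :=
  expR (e * (n - j)%:R - n%:R * W y (gridR n j))
  + expR (L * (n - j)%:R + n%:R * ((4 * M + 4) * (`|y| - B))).

Lemma potential_ge0 n e L B j y : 0 <= potential n e L B j y.
Proof. by rewrite addr_ge0 ?expR_ge0. Qed.

Lemma measurable_potential n e L B j :
  measurable_fun [set: R] (potential n e L B j).
Proof.
have cW : continuous (W ^~ (gridR n j)).
  move=> x; apply/differentiable_continuous/derivable1_diffP.
  by have [] := cd_DW (gs_C1 sub) x (grid_itv n j).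
have mW : measurable_fun [set: R] (W ^~ (gridR n j)) by exact: continuous_measurable_fun.
apply: measurable_funD; apply: measurableT_comp => //.
  by apply: measurable_funB => //; exact: measurable_funM.
apply: measurable_funD => //; apply: measurable_funM => //.
by apply: measurable_funM => //; apply: measurable_funD.
Qed.

(** After [n] is chosen large, a step moves the position by at most [A / n] and the
    time by [1 / n], which stays within the modulus of uniform continuity of
    [DW] and [Wt] near the compact set. *)
Lemma increment_modulus (B A e : R) : 0 < e ->
  exists N, forall n j y x, (N <= n)%N -> (j < n)%N -> `|y| <= B -> `|G x| <= A ->
  forall xi tau, `|xi - y| <= n%:R^-1 * `|G x| ->
    gridR n j <= tau <= gridR n j.+1 ->
    `|(DW xi (gridR n j.+1) - DW y (gridR n j)) * G x
      + (Wt y tau - Wt y (gridR n j))| <= e.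
Proof.
move=> e0; pose D := `|A| + 1.
have D0 : 0 < D by rewrite ltr_pwDr.
have [r1 r10 P1] := continuous_on_strip_unif B (cd_DW_cont (gs_C1 sub))
  (divr_gt0 (divr_gt0 e0 (ltr0n R 2)) D0).
have [r2 r20 P2] := continuous_on_strip_unif B (cd_Wt_cont (gs_C1 sub))
  (divr_gt0 e0 (ltr0n R 2)).
pose rm := Num.min r1 r2.
have rm0 : 0 < rm by rewrite lt_min r10.
(* from this rank on, [D / n] is at most the modulus [rm] *)
exists (Num.truncn (D / rm)).+1 => n j y x Nn jn yB xA xi tau xiy /andP[tau1 tau2].
have n0 : (0 : R) < n%:R by rewrite ltr0n (leq_ltn_trans _ jn).
have nrm : n%:R^-1 * D <= rm.
  rewrite mulrC ler_pdivrMr// mulrC -ler_pdivrMr//.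
  apply: ltW; apply: (lt_le_trans (truncnS_gt _)).
  by rewrite ler_nat.
have D1 : 1 <= D by rewrite lerDr.
have n1 : n%:R^-1 <= rm.
  by apply: le_trans nrm; rewrite ler_peMr// invr_ge0 ltW.
have GD : `|G x| <= D by rewrite (le_trans xA)// (le_trans (ler_norm _))// lerDl.
have gj : 0 <= gridR n j <= 1 := grid_itv n j.
have gj1 : 0 <= gridR n j.+1 <= 1 := grid_itv n j.+1.
have gS := gridS jn.
have r1m : rm <= r1 by rewrite ge_min lexx.
have r2m : rm <= r2 by rewrite ge_min lexx orbT.
have nV0 : 0 <= n%:R^-1 :> R by rewrite invr_ge0 ltW.
have tau01 : 0 <= tau <= 1.
  by case/andP: gj => ? ?; case/andP: gj1 => ? ?; apply/andP; split; lra.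
have d1 : `|DW xi (gridR n j.+1) - DW y (gridR n j)| <= e / 2 / D.
  apply: P1 => //.
    apply: (le_trans xiy); apply: le_trans r1m; apply: le_trans nrm.
    by rewrite ler_wpM2l.
  by rewrite gS addrAC subrr add0r ger0_norm// (le_trans n1).
have d2 : `|Wt y tau - Wt y (gridR n j)| <= e / 2.
  apply: P2 => //; first by rewrite subrr normr0 ltW.
  by rewrite ger0_norm ?subr_ge0//; lra.
apply: (le_trans (ler_normD _ _)); rewrite normrM.
suff : `|DW xi (gridR n j.+1) - DW y (gridR n j)| * `|G x| <= e / 2 by lra.
apply: (@le_trans _ _ (e / 2 / D * D)); first by rewrite ler_pM.
by rewrite divfK// gt_eqF.
Qed.

(** For [`|y| <= 2 * B] the integral of the first term grows by at most the factor
    [expR (e / 2) + expR (- A) * mass], made at most [expR e] by the choice of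
    [A].  For [`|y| > 2 * B] the first term is smaller than the second one, and
    the factor [expR L >= 2 * mass] of the latter pays for both. *)
Lemma potential_step (e L B : R) : 0 < e -> e <= L -> `|W 0 0| + M <= 2 * B ->
  2 * massM <= expR L ->
  exists N, forall n j y, (N <= n)%N -> (j < n)%N ->
  (backward eta G n (q n) (square_weight n) j
    (EFin \o potential n e L B j.+1) y <= (potential n e L B j y)%:E)%E.
Proof.
move=> e0 eL WB kL; have M0 := M_ge0.
have kap0 : 0 <= massM by exact: majorant_mass_ge0.
have gap : 0 < expR e - expR (e / 2) by rewrite subr_gt0 ltr_expR; lra.
(* [A] solves [expR (- A) * (mass + 1) = expR e - expR (e / 2)] *)
pose A := ln ((massM + 1) / (expR e - expR (e / 2))).
have kap1 : 0 < massM + 1 by rewrite ltr_pwDr.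
have kA : expR (- A) * massM <= expR e - expR (e / 2).
  rewrite expRN lnK ?posrE ?divr_gt0// invf_div mulrAC ler_pdivrMr//.
  by apply: ler_wpM2l; [exact: ltW|rewrite lerDl].
have [N NP] := increment_modulus (2 * B) A (divr_gt0 e0 (ltr0n R 2)).
exists N => n j y Nn jn; rewrite /backward.
pose f (x : rVb) := potential n e L B j.+1 (y + n%:R^-1 * G x) * (q n j (y, x))^-1.
under eq_integral do rewrite square_weightM /= -EFinM.
have q0 x : 0 < q n j (y, x).
  by apply: step_density_gt0; [exact: (gs_rho_ge0 sub)|exact: (gs_rho_sum1 sub)].
have f0 x : 0 <= f x by rewrite mulr_ge0 ?potential_ge0// invr_ge0 ltW.
have mf : measurable_fun [set: rVb] f.
  apply: measurable_funM; last first.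
    exact: (measurable_fun_pair2 y (measurable_inv_step_density n j)).
  apply: (measurableT_comp (measurable_potential n e L B j.+1)).
  apply: measurable_funD => //; apply: measurable_funM => //.
  exact: measurable_continuous_borel_rV.
have nj : (n - j)%:R = 1 + (n - j.+1)%:R :> R by rewrite addrC natr1 subnSK.
set V := expR (e * (n - j.+1)%:R - n%:R * W y (gridR n j)).
set Q := expR (L * (n - j.+1)%:R + n%:R * ((4 * M + 4) * (`|y| - B))).
have V0 : 0 <= V by exact: expR_ge0.
have Q0 : 0 <= Q by exact: expR_ge0.
have UE : potential n e L B j y = expR e * V + expR L * Q.
  by rewrite /potential nj /V /Q -!expRD; congr (expR _ + expR _); ring.
have Psi0 x : 0 <= majorantM x by exact: exp_majorant_ge0.
have J0 x : 0 <= kernelM (gridR n j) y x by exact: (kernel_ge0 sub y (grid_itv n j)).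
have fE x : f x =
    expR (e * (n - j.+1)%:R - n%:R * W (y + n%:R^-1 * G x) (gridR n j.+1))
      * (q n j (y, x))^-1
    + expR (L * (n - j.+1)%:R + n%:R * ((4 * M + 4) * (`|y + n%:R^-1 * G x| - B)))
      * (q n j (y, x))^-1 by rewrite /f /potential mulrDl.
have pen x := penalty_step_le_majorant y jn (L * (n - j.+1)%:R) B x.
have [yB|By] := leP `|y| (2 * B).
  apply: (@le_trans _ _ (V * expR (e / 2) + (V * expR (- A) + Q) * massM)%:E).
    apply: (integral_le_combination (f := f) (y := y) cG finH sub (grid_itv n j)) => //.
    - by rewrite mulr_ge0 ?expR_ge0.
    - by rewrite addr_ge0 ?mulr_ge0 ?expR_ge0.
    - move=> x; rewrite (fE x).
      have -> : V * expR (e / 2) * kernelM (gridR n j) y x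
          + (V * expR (- A) + Q) * majorantM x =
          (V * (expR (e / 2) * kernelM (gridR n j) y x) + V * (expR (- A) * majorantM x))
          + Q * majorantM x by ring.
      apply: (lerD _ (pen x)).
      have [GA|AG] := leP `|G x| A.
        have := value_step_le_kernel (y := y) jn (e * (n - j.+1)%:R) (NP n j y x Nn jn yB GA).
        move=> /le_trans; apply.
        by rewrite lerDl; do 2 apply: mulr_ge0 => //; exact: expR_ge0.
      have := value_step_tail y jn (e * (n - j.+1)%:R) (ltW AG).
      move=> /le_trans; apply.
      by rewrite lerDr; do 2 apply: mulr_ge0 => //; exact: expR_ge0.
  rewrite lee_fin UE mulrDl addrA lerD//.
    rewrite -mulrA -mulrDr [leRHS]mulrC ler_wpM2l//; lra.
  by rewrite mulrC ler_wpM2r//; lra.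
have VQ : V <= Q.
  rewrite ler_expR; apply: lerD; first by rewrite ler_wpM2r.
  rewrite -mulrN ler_wpM2l//.
  have := growth_bound sub le_M y (grid_itv n j).
  have My := mulr_ge0 M0 (normr_ge0 y).
  have := ler_wpM2l M0 (ltW By).
  rewrite ler_norml => MBY /andP[WM _].
  have := normr_ge0 y; lra.
apply: (@le_trans _ _ (0 + (V + Q) * massM)%:E).
  apply: (integral_le_combination (f := f) (y := y) cG finH sub (grid_itv n j)) => //.
  - by rewrite addr_ge0.
  - move=> x; rewrite (fE x).
    have -> : 0 * kernelM (gridR n j) y x + (V + Q) * majorantM x =
      V * majorantM x + Q * majorantM x by ring.
    apply: (lerD _ (pen x)); exact: value_step_le_majorant.
rewrite add0r lee_fin UE.
apply: (@le_trans _ _ (expR L * Q)); last by rewrite lerDr mulr_ge0 ?expR_ge0.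
apply: (@le_trans _ _ (2 * massM * Q)); last by rewrite ler_wpM2r.
by rewrite mulrAC ler_wpM2r//; lra.
Qed.

End Potential.

(** * The estimator *)

Lemma pos_part_ge0 (R : realType) (x : R) : 0 <= pos_part x.
Proof. by rewrite /pos_part le_max lexx orbT. Qed.

(** The linear payoff is compared with [expR `|y|], whose exponential moments are
    at hand. *)
Lemma payoff_le_expR (R : realType) (c lam y : R) : 0 < c -> 0 < lam ->
  pos_part (lam * (y - c) + 1) <= (lam + 1) * expR `|y|.
Proof.
move=> c0 lam0; have E1 : 1 + `|y| <= expR `|y| by exact: expR_ge1Dx.
have y0 := normr_ge0 y; have yy := ler_norm y.
rewrite /pos_part ge_max; apply/andP; split; last first.
  by rewrite mulr_ge0 ?expR_ge0// addr_ge0// ltW.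
apply: (@le_trans _ _ ((lam + 1) * (1 + `|y|))); last first.
  by rewrite ler_wpM2l// addr_ge0// ltW.
have lc := mulr_ge0 (ltW lam0) (ltW c0).
have := ler_wpM2l (ltW lam0) yy.
by lra.
Qed.

Lemma measurable_pos_part (R : realType) :
  measurable_fun [set: R] (@pos_part R).
Proof. by apply: measurable_maxr. Qed.

Lemma measurable_payoff (R : realType) (c lam : R) :
  measurable_fun [set: R] (fun y => pos_part (lam * (y - c) + 1)).
Proof.
apply: (measurableT_comp (@measurable_pos_part R)).
by apply: measurable_funD => //; apply: measurable_funM => //; exact: measurable_funB.
Qed.

Section IidMean.
Context {R : realType} {h : nat}.
Local Notation rVb := (borel_rV R h).
Variables (eta : probability rVb R) (G : 'rV[R]_h -> R).
Hypothesis cG : continuous G.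
Context {d : measure_display} {Omega : measurableType d}.
Variables (P : probability Omega R) (X : nat -> {RV P >-> rVb}).
Hypothesis iidX : iid X eta.

(** Independent samples have conditional density 1, so this is the recursion with
    density and weight both equal to 1. *)
Lemma iid_expectation (n : nat) (F : R -> R) :
  measurable_fun [set: R] F -> (forall y, 0 <= F y) ->
  ('E_P[fun w => F (sample_mean G X n w)] =
   iter n (translation_mean eta G n) (EFin \o F) 0%R)%E.
Proof.
move=> mF F0; rewrite unlock.
pose Y j w := n%:R^-1 * \sum_(i < j) G (X i w).
have Y0 w : Y 0%N w = 0 by rewrite /Y big_ord0 mulr0.
have YS j w : (j < n)%N -> Y j.+1 w = Y j w + n%:R^-1 * G (X j w).
  by move=> _; rewrite /Y big_ord_recr mulrDr.
have dens := @iid_conditional_density _ _ _ _ _ P eta X iidX Y n.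
have m1 (j : nat) : measurable_fun [set: R * rVb] (fun _ => 1 : R).
  exact: measurable_cst.
have p1 (j : nat) (z : R * rVb) : 0 <= 1 :> R by [].
have mG := measurable_continuous_borel_rV cG.
have := @expectation_weight_translation _ _ _ _ _ P eta X G Y n _ mG Y0 YS
  m1 p1 dens _ m1 p1 (EFin \o F) (fun _ _ => mulr1 1).
move=> <-//; last by apply/measurable_EFinP.
- apply: eq_integral => w _ /=.
  by rewrite /weight big1// mule1.
Qed.

End IidMean.

Section Estimator.
Context {R : realType} {h : nat}.
Local Notation rVb := (borel_rV R h).
Variables (eta : probability rVb R) (G : 'rV[R]_h -> R) (c : R).
Hypothesis cG : continuous G.
Hypothesis finH : forall a alpha, (logmgf eta G a alpha < +oo)%E.
Hypothesis c_gt0 : 0 < c.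
Context {K : nat}.
Variables (W : R -> R -> R)
  (rho : 'I_K -> R -> R -> R) (abar : 'I_K -> R -> R -> 'rV[R]_h)
  (Wt DW : R -> R -> R) (r s : 'I_K -> R -> R -> R).
Hypothesis sub : generalized_subsolution eta G W rho abar Wt DW r s.

Local Notation q := (step_density eta G rho abar).

Let crho k t : 0 <= t <= 1 -> continuous (rho k ^~ t).
Proof.
by move=> t01; apply: continuous_on_strip_slice => //; have [] := gs_continuous sub k.
Qed.

Let cabar k t : 0 <= t <= 1 -> continuous (abar k ^~ t).
Proof.
by move=> t01; apply: continuous_on_strip_slice => //; have [] := gs_continuous sub k.
Qed.

Let q_gt0 n j z : 0 < q n j z.
Proof.
by apply: step_density_gt0; [exact: (gs_rho_ge0 sub)|exact: (gs_rho_sum1 sub)].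
Qed.

Let mq n j : measurable_fun [set: R * rVb] (q n j).
Proof. exact: measurable_step_density. Qed.

Let mG : measurable_fun [set: rVb] (G : rVb -> R).
Proof. exact: measurable_continuous_borel_rV. Qed.

Section Scheme.
Context {d : measure_display} {Omega : measurableType d}.
Variables (P : probability Omega R) (n : nat) (X : nat -> {RV P >-> rVb})
  (I : nat -> Omega -> 'I_K) (Y : nat -> Omega -> R).
Hypothesis scheme : sampling_scheme eta G rho abar n X I Y.
Hypothesis n_gt0 : (0 < n)%N.

Let dens : conditional_density eta X Y n (q n).
Proof. exact: (scheme_conditional_density cG finH (gs_rho_ge0 sub) crho cabar scheme). Qed.

Let q_ge0 j z : 0 <= q n j z. Proof. exact: ltW. Qed.

Let inv_q (j : nat) (z : R * rVb) := (q n j z)^-1.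

Let minv_q j : measurable_fun [set: R * rVb] (inv_q j).
Proof. exact: (measurable_inv_step_density cG finH sub). Qed.

Let inv_q_ge0 j z : 0 <= inv_q j z. Proof. by rewrite invr_ge0. Qed.

Lemma likelihood_ratioE w :
  likelihood_ratio eta G rho abar n X Y w = weight X Y inv_q n w.
Proof.
apply: eq_bigr => j _; rewrite /inv_q /step_density /=.
by rewrite gridE// ltnW.
Qed.

Lemma square_likelihood_ratioE w :
  likelihood_ratio eta G rho abar n X Y w ^+ 2 =
  weight X Y (square_weight eta G rho abar n) n w.
Proof.
by rewrite likelihood_ratioE /weight -prodrXl.
Qed.

Let mY : measurable_fun [set: Omega] (Y n).
Proof.
apply: (@history_fun_measurable _ _ _ _ _ P X _ _ n).
exact: (history_fun_Y mG (ss_Y0 scheme) (ss_YS scheme)).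
Qed.

Let mweight ell : (forall j, measurable_fun [set: R * rVb] (ell j)) ->
  measurable_fun [set: Omega] (weight X Y ell n).
Proof.
move=> mell; apply: (@history_fun_measurable _ _ _ _ _ P X _ _ n).
exact: (history_fun_weight mG (ss_Y0 scheme) (ss_YS scheme)).
Qed.

Lemma measurable_IS_estimator lam :
  measurable_fun [set: Omega] (IS_estimator eta G rho abar c n X Y lam).
Proof.
apply: measurable_funM; first exact: (measurableT_comp (measurable_payoff c lam)).
by rewrite (_ : likelihood_ratio _ _ _ _ _ _ _ = weight X Y inv_q n);
  [exact: mweight|apply/funext => w; exact: likelihood_ratioE].
Qed.

Lemma IS_estimator_ge0 lam w : 0 <= IS_estimator eta G rho abar c n X Y lam w.
Proof.
by rewrite mulr_ge0 ?pos_part_ge0// likelihood_ratioE weight_ge0.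
Qed.

Lemma expectation_IS_estimator lam :
  ('E_P[IS_estimator eta G rho abar c n X Y lam] =
   iter n (translation_mean eta G n)
     (EFin \o (fun y => pos_part (lam * (y - c) + 1))) 0%R)%E.
Proof.
rewrite -(expectation_weight_translation mG (ss_Y0 scheme) (ss_YS scheme)
  (mq n) q_ge0 dens minv_q inv_q_ge0).
- rewrite unlock; apply: eq_integral => w _.
  by rewrite /IS_estimator likelihood_ratioE EFinM.
- by move=> j z; rewrite mulVf// gt_eqF.
- by apply/measurable_EFinP; exact: measurable_payoff.
- by move=> y; rewrite lee_fin pos_part_ge0.
Qed.

(** The payoff is at most a multiple of [expR `|y|], and the translation operator
    multiplies this function by at most a finite constant at each step. *)
Lemma integrable_IS_estimator lam : 0 < lam ->
  P.-integrable [set: Omega] (EFin \o IS_estimator eta G rho abar c n X Y lam).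
Proof.
move=> lam0; apply/integrableP; split.
  by apply/measurable_EFinP; exact: measurable_IS_estimator.
under eq_integral do rewrite gee0_abs ?lee_fin ?IS_estimator_ge0//.
pose k1 := fine (\int[eta]_x (expR (1 * abs_size G x))%:E)%E.
have k1E : (\int[eta]_x (expR (1 * abs_size G x))%:E = k1%:E)%E.
  rewrite /k1 fineK// ge0_fin_numE; first exact: integral_expR_abs_size_lty.
  by apply: integral_ge0 => x _; rewrite lee_fin expR_ge0.
have k10 : 0 <= k1.
  by rewrite -lee_fin -k1E; apply: integral_ge0 => x _; rewrite lee_fin expR_ge0.
pose U (j : nat) (y : R) : R := (lam + 1) * (k1 ^+ (n - j) * expR `|y|).
have lam10 : 0 <= lam + 1 by rewrite addr_ge0// ltW.
have U0 j y : 0 <= U j y by rewrite !mulr_ge0 ?expR_ge0 ?exprn_ge0.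
have mU j : measurable_fun [set: R] (U j).
  by do 2 apply: measurable_funM => //; apply: measurableT_comp => //.
have Ustep j y : (j < n)%N ->
    (backward eta G n (q n) inv_q j (EFin \o U j.+1) y <= (U j y)%:E)%E.
  move=> jn; rewrite /backward.
  under eq_integral => x _ do rewrite mulVf ?gt_eqF// mule1 /=.
  have Uj : U j y = (lam + 1) * (k1 ^+ (n - j.+1) * expR `|y|) * k1.
    by rewrite /U -(subnSK jn) exprSr; ring.
  have a0 : 0 <= (lam + 1) * (k1 ^+ (n - j.+1) * expR `|y|).
    by rewrite !mulr_ge0 ?expR_ge0 ?exprn_ge0.
  have mexp : measurable_fun [set: rVb]
      (fun x : rVb => (expR (1 * abs_size G x))%:E).
    apply/measurable_EFinP; apply: measurableT_comp => //.
    by apply: measurable_funM => //; exact: measurable_abs_size.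
  rewrite Uj EFinM -k1E -ge0_integralZl_EFin//.
  apply: ge0_le_integral => //.
  - by move=> x _; rewrite lee_fin.
  - apply/measurable_EFinP; apply: (measurableT_comp (mU j.+1)).
    by apply: measurable_funD => //; exact: measurable_funM.
  - exact: emeasurable_funM.
  - move=> x _; rewrite -EFinM lee_fin /U -!mulrA.
    rewrite ler_wpM2l// ler_wpM2l ?exprn_ge0// -expRD ler_expR mul1r.
    rewrite (le_trans (ler_normD _ _))// lerD2l normrM.
    apply: (@le_trans _ _ `|G x|); last by rewrite /abs_size lerDr sumr_ge0.
    rewrite ler_piMl// ger0_norm ?invr_ge0// invf_le1 ?ltr0n//.
    by rewrite ler1n.
have := expectation_weight_le mG (ss_Y0 scheme) (ss_YS scheme) (mq n) q_ge0
  dens minv_q inv_q_ge0 mU U0 Ustep.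
move=> /le_lt_trans/(_ (ltry _)); apply: le_lt_trans.
apply: ge0_le_integral.
- exact: measurableT.
- by move=> w _; rewrite lee_fin IS_estimator_ge0.
- by apply/measurable_EFinP; exact: measurable_IS_estimator.
- apply/measurable_EFinP; apply: measurable_funM; last exact: mweight.
  exact: (measurableT_comp (mU n)).
- move=> w _; rewrite lee_fin /IS_estimator likelihood_ratioE.
  rewrite ler_wpM2r ?weight_ge0// /U subnn expr0 mul1r.
  exact: payoff_le_expR.
Qed.

Lemma second_moment_le (M e L B C lam : R) : 0 <= C ->
  (forall y, pos_part (lam * (y - c) + 1) ^+ 2 <= C * potential W M n e L B n y) ->
  (forall j y, (j < n)%N ->
    (backward eta G n (q n) (square_weight eta G rho abar n) j
      (EFin \o potential W M n e L B j.+1) y <= (potential W M n e L B j y)%:E)%E) ->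
  ('E_P[fun w => (IS_estimator eta G rho abar c n X Y lam w ^+ 2)%R]
    <= (C * potential W M n e L B 0 0)%:E)%E.
Proof.
move=> C0 payoffC step; rewrite unlock.
have mell j : measurable_fun [set: R * rVb] (square_weight eta G rho abar n j).
  by apply: measurable_funX; exact: minv_q.
have ell0 j z : 0 <= square_weight eta G rho abar n j z by exact: sqr_ge0.
have mU j : measurable_fun [set: R] (potential W M n e L B j).
  exact: (measurable_potential sub).
have U0 j y : 0 <= potential W M n e L B j y by exact: potential_ge0.
have bound := expectation_weight_le mG (ss_Y0 scheme) (ss_YS scheme) (mq n) q_ge0
  dens mell ell0 mU U0 step.
have mUw : measurable_fun [set: Omega] (fun w =>
    (potential W M n e L B n (Y n w) * weight X Y (square_weight eta G rho abar n) n w)%:E).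
  apply/measurable_EFinP; apply: measurable_funM; last exact: mweight.
  exact: (measurableT_comp (mU n)).
rewrite EFinM; apply: (@le_trans _ _ (C%:E * \int[P]_w
  (potential W M n e L B n (Y n w) * weight X Y (square_weight eta G rho abar n) n w)%:E)%E);
  last by rewrite lee_wpmul2l ?lee_fin.
rewrite -ge0_integralZl_EFin//; last first.
  by move=> w _; rewrite lee_fin mulr_ge0// weight_ge0.
apply: ge0_le_integral => //.
- by move=> w _; rewrite lee_fin sqr_ge0.
- apply/measurable_EFinP; apply: measurable_funX; exact: measurable_IS_estimator.
- exact: emeasurable_funM.
- move=> w _; rewrite -EFinM lee_fin /IS_estimator exprMn square_likelihood_ratioE mulrA.
  by rewrite ler_wpM2r ?weight_ge0.
Qed.

End Scheme.

(** By continuity [W _ 1] is still negative on a neighbourhood of [c] of radius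
    [e]; with [lam >= 2 / e] the payoff is null to the left of it. *)
Lemma terminal_margin : (forall y, c <= y -> W y 1 < 0) ->
  exists2 gamma, 0 < gamma & forall lam y, gamma <= lam ->
    0 < lam * (y - c) + 1 -> W y 1 <= 0.
Proof.
move=> W1; have one01 : 0 <= (1 : R) <= 1 by rewrite ler01 lexx.
have cW : {for c, continuous (W ^~ 1)}.
  apply/differentiable_continuous/derivable1_diffP.
  by have [] := cd_DW (gs_C1 sub) c one01.
have Wc : 0 < - W c 1 by rewrite oppr_gt0; exact: W1.
have /cvgrPdist_lt/(_ _ Wc) := cW.
move=> /nbhs_ballP[e /= e0 eP]; exists (2 / e); first by rewrite divr_gt0.
move=> lam y gl pos.
have lam0 : 0 < lam by rewrite (lt_le_trans _ gl)// divr_gt0.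
have [cy|yc] := leP c y; first exact/ltW/W1.
have le2 : 2 <= lam * e by rewrite -ler_pdivrMr.
have dist : `|c - y| < e.
  rewrite gtr0_norm ?subr_gt0//.
  suff : lam * (c - y) < lam * e by rewrite ltr_pM2l.
  by apply: lt_le_trans le2; move: pos; rewrite !mulrBr; lra.
have := eP y dist; rewrite ltr_norml => /andP[+ _]; lra.
Qed.

(** Where the payoff is positive, [W y 1 <= 0] makes the first term of the potential
    at least 1, which controls the payoff for [`|y| <= 2 * B]; beyond, the second
    term grows faster than the square of the payoff. *)
Lemma payoff_le_potential (M e L B lam y : R) (n : nat) : (0 < n)%N ->
  0 <= M -> 0 <= B -> 0 < lam ->
  (0 < lam * (y - c) + 1 -> W y 1 <= 0) ->
  pos_part (lam * (y - c) + 1) ^+ 2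
    <= ((lam + 1) ^+ 2 * expR (4 * B)) * potential W M n e L B n y.
Proof.
move=> n0 M0 B0 lam0 Wneg.
have pot0 : 0 <= potential W M n e L B n y by exact: potential_ge0.
have C0 : 0 <= (lam + 1) ^+ 2 * expR (4 * B) by rewrite mulr_ge0 ?sqr_ge0 ?expR_ge0.
have [le0|gt0] := leP (lam * (y - c) + 1) 0.
  by rewrite /pos_part max_r// expr0n /= mulr_ge0.
apply: (@le_trans _ _ ((lam + 1) ^+ 2 * expR (2 * `|y|))).
  have -> : expR (2 * `|y|) = expR `|y| ^+ 2 by rewrite expRM_natl.
  rewrite -exprMn; apply: lerXn2r; rewrite ?nnegrE ?pos_part_ge0//.
    by rewrite mulr_ge0 ?expR_ge0// addr_ge0// ltW.
  exact: payoff_le_expR.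
rewrite -mulrA ler_wpM2l ?sqr_ge0//.
have gn : grid n n = (1 : R) by rewrite gridE// divff// pnatr_eq0 -lt0n.
have n1 : 1 <= n%:R :> R by rewrite ler1n.
have nW : 0 <= - (n%:R * W y 1).
  by rewrite -mulrN mulr_ge0// oppr_ge0 Wneg.
rewrite /potential gn subnn !mulr0 !add0r.
have [yB|By] := leP `|y| (2 * B).
  rewrite -[leLHS]mulr1; apply: ler_pM; rewrite ?expR_ge0//.
    by rewrite ler_expR; lra.
  apply: (@le_trans _ _ (expR (- (n%:R * W y 1)))); last by rewrite lerDl expR_ge0.
  by rewrite -[leLHS]expR0 ler_expR.
rewrite -[leLHS]mul1r; apply: ler_pM; rewrite ?expR_ge0//.
  by rewrite -[leLHS]expR0 ler_expR mulr_ge0.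
apply: (@le_trans _ _ (expR (n%:R * ((4 * M + 4) * (`|y| - B))))); last first.
  by rewrite lerDr expR_ge0.
rewrite ler_expR.
have yB0 : 0 <= `|y| - B by lra.
have MyB := mulr_ge0 M0 yB0.
apply: (@le_trans _ _ ((4 * M + 4) * (`|y| - B))); first by lra.
by rewrite ler_peMl//; lra.
Qed.

Section Asymptotics.
Variables (d : nat -> measure_display) (Omega : forall n, measurableType (d n))
  (P : forall n, probability (Omega n) R)
  (X : forall n, nat -> {RV (P n) >-> rVb})
  (I : forall n, nat -> Omega n -> 'I_K) (Y : forall n, nat -> Omega n -> R).
Hypothesis scheme : forall n, (0 < n)%N ->
  sampling_scheme eta G rho abar n (X n) (@I n) (@Y n).

(** The threshold [B] is chosen after [L], large enough for the second term of the
    potential to be at most [expR (- n * W 0 0)] at the origin. *)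
Lemma second_moment_rate (lam e : R) : 0 < lam -> 0 < e ->
  (forall y, 0 < lam * (y - c) + 1 -> W y 1 <= 0) ->
  exists2 C, 0 < C & exists N, forall n, (N <= n)%N -> (0 < n)%N ->
  ('E_(P n)[fun w => (IS_estimator eta G rho abar c n (X n) (@Y n) lam w ^+ 2)%R]
    <= (C * expR (n%:R * (e - W 0 0)))%:E)%E.
Proof.
move=> lam0 e0 Wneg; have [M1 M1P] := gs_bounded sub.
pose M := Num.max M1 0.
have M0 : 0 <= M by rewrite le_max lexx orbT.
have le_M k y t : 0 <= t <= 1 -> [/\ `|r k y t| <= M, `|s k y t| <= M,
    `|rho k y t| <= M & `|abar k y t| <= M].
  by move=> t01; have [? ? ? ?] := M1P k y t t01; split; rewrite le_max; apply/orP; left.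
pose kap := majorant_mass eta G M.
have kap0 : 0 <= kap by exact: majorant_mass_ge0.
have kap1 : 0 < 2 * kap + 1 by rewrite ltr_pwDr// mulr_ge0.
have ln0 : 0 <= ln (2 * kap + 1) by rewrite ln_ge0// lerDr mulr_ge0.
pose L := ln (2 * kap + 1) + e.
have eL : e <= L by rewrite lerDr.
have L0 : 0 <= L by rewrite addr_ge0// ltW.
have kL : 2 * kap <= expR L.
  rewrite /L expRD lnK ?posrE//.
  apply: (@le_trans _ _ (2 * kap + 1)); first by rewrite lerDl.
  by rewrite ler_peMr ?ltW// -expR0 ltr_expR.
have W00 := normr_ge0 (W 0 0).
(* large against the growth of [W], and against [L] and [W 0 0] at the origin *)
pose B := `|W 0 0| + M + L.
have B0 : 0 <= B by rewrite /B; lra.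
have WB : `|W 0 0| + M <= 2 * B by rewrite /B; lra.
have [N NP] := potential_step cG finH sub M0 le_M e0 eL WB kL.
pose C := (lam + 1) ^+ 2 * expR (4 * B).
have C0 : 0 < C by rewrite mulr_gt0 ?expR_gt0// exprn_gt0// ltr_wpDr// ltW.
exists (C * 2); first by rewrite mulr_gt0.
exists N => n Nn n0.
have := @second_moment_le _ _ (P n) n (X n) (@I n) (@Y n) (scheme n0)
  M e L B C lam (ltW C0) (fun y => payoff_le_potential e L n0 M0 B0 lam0 (Wneg y))
  (fun j y jn => NP n j y Nn jn).
move=> /le_trans; apply; rewrite lee_fin -[leRHS]mulrA.
apply: ler_wpM2l; first exact: ltW.
rewrite /potential (gridE (leq0n n)) mul0r subn0 normr0.
rewrite [leRHS]mulr_natl [leRHS]mulr2n; apply: lerD; rewrite ler_expR.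
  by rewrite mulrBr mulrC.
rewrite [L * _]mulrC -mulrDr ler_wpM2l//.
have MB := mulr_ge0 M0 B0.
have := ler_norm (W 0 0); rewrite sub0r mulrN mulrDl.
suff : L + W 0 0 <= 4 * B by lra.
by rewrite /B; have := ler_norm (W 0 0); lra.
Qed.

(** Half of [e] is lost in the recursion; the other half dominates [ln C / n] for
    large [n]. *)
Lemma limsup_second_moment (lam : R) : 0 < lam ->
  (forall y, 0 < lam * (y - c) + 1 -> W y 1 <= 0) ->
  (limn_esup (fun n => (n%:R^-1)%:E *
     lne 'E_(P n)[fun w =>
       (IS_estimator eta G rho abar c n (X n) (@Y n) lam w ^+ 2)%R])
   <= (- W 0 0)%:E)%E.
Proof.
move=> lam0 Wneg; apply/lee_addgt0Pr => e e0.
have e20 : 0 < e / 2 by rewrite divr_gt0.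
have [C C0 [N NP]] := second_moment_rate lam0 e20 Wneg.
pose N2 := (Num.truncn (`|ln C| / (e / 2))).+1.
pose V := [set n | (maxn N N2 <= n)%N].
rewrite /limn_esup limf_esupE.
apply: (@le_trans _ _ (ereal_sup [set (n%:R^-1)%:E *
     lne 'E_(P n)[fun w =>
       (IS_estimator eta G rho abar c n (X n) (@Y n) lam w ^+ 2)%R] | n in V])%E).
  apply: ereal_inf_lbound; exists V => //.
  by exists (maxn N N2).
apply: ub_ereal_sup => _ [n /= Vn <-].
have /andP[Nn N2n] : (N <= n)%N && (N2 <= n)%N by rewrite -geq_max.
have n0 : (0 < n)%N by exact: leq_trans N2n.
have n0' : (0 : R) < n%:R by rewrite ltr0n.
have bound := NP n Nn n0.
have ZE0 : (0 <= 'E_(P n)[fun w =>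
    (IS_estimator eta G rho abar c n (X n) (@Y n) lam w ^+ 2)%R])%E.
  by apply: expectation_ge0 => w; exact: sqr_ge0.
have lnZ : (lne 'E_(P n)[fun w =>
    (IS_estimator eta G rho abar c n (X n) (@Y n) lam w ^+ 2)%R]
  <= (ln C + n%:R * (e / 2 - W 0 0))%:E)%E.
  have X0 : 0 < C * expR (n%:R * (e / 2 - W 0 0)) by rewrite mulr_gt0 ?expR_gt0.
  have <- : (lne (C * expR (n%:R * (e / 2 - W 0 0)))%:E
      = (ln C + n%:R * (e / 2 - W 0 0))%:E)%E.
    by rewrite lne_EFin// lnM ?posrE ?expR_gt0// expRK.
  rewrite lee_lne//.
  - by rewrite in_itv /= ZE0 leey.
  - by rewrite in_itv /= lee_fin ltW// leey.
apply: (@le_trans _ _ ((n%:R^-1)%:E * (ln C + n%:R * (e / 2 - W 0 0))%:E)%E).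
  by rewrite lee_wpmul2l// lee_fin invr_ge0 ltW.
rewrite -EFinM -EFinD lee_fin mulrDr mulKf ?gt_eqF//.
have lnC : n%:R^-1 * ln C <= e / 2.
  apply: (@le_trans _ _ (n%:R^-1 * `|ln C|)).
    by rewrite ler_wpM2l ?ler_norm// invr_ge0 ltW.
  rewrite mulrC ler_pdivrMr// mulrC -ler_pdivrMr//.
  apply: ltW; apply: (lt_le_trans (truncnS_gt _)).
  by rewrite ler_nat.
by lra.
Qed.

End Asymptotics.
End Estimator.

Theorem theorem4p3 (R : realType) (h : nat)
  (eta : probability (borel_rV R h) R) (G : 'rV[R]_h -> R) (c : R)
  (K : nat) (W : R -> R -> R)
  (rho : 'I_K -> R -> R -> R) (abar : 'I_K -> R -> R -> 'rV[R]_h)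
  (d0 : measure_display) (Omega0 : measurableType d0) (P0 : probability Omega0 R)
  (X : nat -> {RV P0 >-> borel_rV R h})
  (d : nat -> measure_display) (Omega : forall n, measurableType (d n))
  (P : forall n, probability (Omega n) R)
  (Xbar : forall n, nat -> {RV (P n) >-> borel_rV R h})
  (I : forall n, nat -> Omega n -> 'I_K)
  (Ybar : forall n, nat -> Omega n -> R) :
  continuous G ->
  iid X eta ->
  0 < c ->
  (forall (a : 'rV[R]_h) (alpha : R), (logmgf eta G a alpha < +oo)%E) ->
  is_generalized_subsolution eta G W rho abar ->
  (forall y, c <= y -> W y 1 < 0) ->
  (forall n, (0 < n)%N ->
    sampling_scheme eta G rho abar n (Xbar n) (I n) (Ybar n)) ->
  (forall n lam, (0 < n)%N -> 0 < lam ->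
    unbiased_estimator (P n)
      (IS_estimator eta G rho abar c n (Xbar n) (Ybar n) lam)
      'E_P0[fun w => pos_part (lam * (sample_mean G X n w - c) + 1)]%E) /\
  (exists2 gamma : R, 0 < gamma &
    (ereal_sup
       [set limn_esup (fun n => (n%:R^-1)%:E *
               lne 'E_(P n)[fun w =>
                 (IS_estimator eta G rho abar c n (Xbar n) (Ybar n) lam w ^+ 2)%R])
       | lam in [set lam : R | (gamma <= lam)%R]]
     <= (- W 0 0)%:E)%E).
Proof.
move=> cG iidX c_gt0 finH [Wt [DW [r [s sub]]]] W1 scheme; split.
  move=> n lam n_gt0 lam_gt0; split.
    exact: (integrable_IS_estimator cG finH c_gt0 sub (scheme n n_gt0)).
  rewrite (expectation_IS_estimator c cG finH sub (scheme n n_gt0)).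
  rewrite (iid_expectation cG iidX n (measurable_payoff c lam))// => y.
  exact: pos_part_ge0.
have [gamma gamma_gt0 margin] := terminal_margin sub W1.
exists gamma => //; apply: ub_ereal_sup => _ [lam /= gamma_lam <-].
have lam_gt0 : 0 < lam by exact: lt_le_trans gamma_lam.
apply: (limsup_second_moment cG finH c_gt0 sub scheme lam_gt0) => y.
exact: margin.
Qed.
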